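(* Let $q\ge 7$ be an odd prime power and let $\mathcal{L}'''$, $\mathcal{L}'$, $\mathcal{L}''$ be as in the context. Then $\mathcal{L}'''$ is not equivalent to any of the previously known Cameron--Liebler line classes with parameter $(q^2+1)/2$; that is, there is no collineation of $\mathrm{PG}(3,q)$ mapping $\mathcal{L}'''$ onto $\mathcal{L}'$ or onto $\mathcal{L}''$, nor onto any Cameron--Liebler line class of the form $\mathcal{X}\cup\mathcal{Y}$ or $\mathcal{X}\cup\mathcal{Z}$, where $\mathcal{X}$ is a Cameron--Liebler line class with parameter $(q^2-1)/2$, $\mathcal{Y}$ is the set of all lines of a plane and $\mathcal{Z}$ the set of all lines through a point, disjoint from $\mathcal{X}$.
   Context: A Cameron--Liebler line class of $\mathrm{PG}(3,q)$ with parameter $x$ is a set of lines such that every line spread contains exactly $x$ of its lines. Let $q$ be a power of an odd prime, with homogeneous coordinates $(X_1,X_2,X_3,X_4)$ on $\mathrm{PG}(3,q)$. Fix a non-square $\omega\in\mathrm{GF}(q)$. For $\lambda\in\mathrm{GF}(q)$ let $\mathcal{E}_\lambda$ be the elliptic quadric $X_1^2-\omega X_2^2+\lambda X_4^2+X_3X_4=0$, and let $\mathcal{E}=\mathcal{E}_0$, with quadratic form $Q(X)=X_1^2-\omega X_2^2+X_3X_4$. Let $O_s$ (resp. $O_n$) be the set of points $X$ with $Q(X)$ a non-zero square (resp. non-square). On a line meeting $\mathcal{E}$ in exactly one point (tangent line), the $q$ points off $\mathcal{E}$ all lie in $O_s$ or all in $O_n$; let $\mathcal{L}_0$ be the set of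 tangent lines whose $q$ points off $\mathcal{E}$ lie in $O_s$. Let $\mathcal{L}_2$ be the set of lines meeting $\mathcal{E}$ in $2$ points and $\mathcal{L}_3$ the set of lines disjoint from $\mathcal{E}$. Let $\pi$ be the plane $X_4=0$, $U_3=(0,0,1,0)$, and $\pi_0$ (resp. $\pi_1$) the set of points $X\in\pi$ with $Q(X)$ a non-zero square (resp. a non-square). Fix a non-zero square $\lambda_1$ and a non-square $\lambda_2$ in $\mathrm{GF}(q)$. Define $\mathcal{T}_{10}=\{r\in\mathcal{L}_2: |r\cap\mathcal{E}_{\lambda_1}|=1,\ |r\cap\pi_0|=1\}$, $\mathcal{T}_{11}=\{r\in\mathcal{L}_3: |r\cap\mathcal{E}_{\lambda_1}|=1,\ |r\cap\pi_1|=1\}$, $\mathcal{T}_{20}=\{r\in\mathcal{L}_3: |r\cap\mathcal{E}_{\lambda_2}|=1,\ |r\cap\pi_0|=1\}$, $\mathcal{T}_{21}=\{r\in\mathcal{L}_2: |r\cap\mathcal{E}_{\lambda_2}|=1,\ |r\cap\pi_1|=1\}$, $\mathcal{A}=\mathcal{T}_{11}\cup\mathcal{T}_{20}$, $\mathcal{B}=\mathcal{T}_{10}\cup\mathcal{T}_{21}$. Let $\mathcal{L}'=\mathcal{L}_0\cup\mathcal{L}_3$ (the Bruen--Drudge Cameron--Liebler line class with parameter $(q^2+1)/2$), and $\mathcal{L}'''=(\mathcal{L}'\setminus\mathcal{A})\cup\mathcal{B}$. Let $\mathcal{L}_3'$ be the set of lines of $\mathcal{L}_3$ contained in $\pi$,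 $\mathcal{L}_2'$ the set of lines of $\mathcal{L}_2$ through $U_3$, and $\mathcal{L}''=(\mathcal{L}'\setminus\mathcal{L}_3')\cup\mathcal{L}_2'$ (a Cameron--Liebler line class with parameter $(q^2+1)/2$). The previously known Cameron--Liebler line classes with parameter $(q^2+1)/2$ are $\mathcal{L}'$, $\mathcal{L}''$, and classes $\mathcal{X}\cup\mathcal{Y}$, $\mathcal{X}\cup\mathcal{Z}$ as in the claim. *)

(* Defs.v *)
From HB Require Import structures.
From mathcomp Require Import all_boot all_order all_fingroup all_algebra.

Set Implicit Arguments.
Unset Strict Implicit.
Unset Printing Implicit Defensive.

Import GRing.Theory.
Local Open Scope ring_scope.

Section FiniteSpace.
(* Provides the canonical subType structure of {vspace vT} over matrices. *)
Import VectorInternalTheory.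
HB.instance Definition _ (F : finFieldType) (vT : vectType F) :=
  [Countable of {vspace vT} by <:].
HB.instance Definition _ (F : finFieldType) (vT : vectType F) :=
  [Finite of {vspace vT} by <:].
End FiniteSpace.

(* Vector subspaces of F^4 of dimension k: the points (k = 1), lines (k = 2)
   and planes (k = 3) of PG(3, #|F|). *)
Record subsp (F : finFieldType) (k : nat) := Subsp {
  subsp_val :> {vspace 'rV[F]_4};
  subsp_dim : \dim subsp_val == k }.

HB.instance Definition _ (F : finFieldType) (k : nat) :=
  [isSub of subsp F k for @subsp_val F k].
HB.instance Definition _ (F : finFieldType) (k : nat) :=
  [Countable of subsp F k by <:].
HB.instance Definition _ (F : finFieldType) (k : nat) :=
  [Finite of subsp F k by <:].

Notation point F := (subsp F 1).
Notation line F := (subsp F 2).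
Notation plane F := (subsp F 3).

Section Geometry.

Variable F : finFieldType.
Implicit Types (P : point F) (l m : line F) (L M X : {set line F}).

Definition pts (l : line F) : {set point F} := [set P : point F | (P <= l)%VS].

Definition lines_of_plane (A : plane F) : {set line F} :=
  [set l : line F | (l <= A)%VS].

Definition lines_through (P : point F) : {set line F} :=
  [set l : line F | (P <= l)%VS].

Definition line_spread (S : {set line F}) : Prop :=
  forall P, #|[set l in S | P \in pts l]| = 1%N.

Definition cameron_liebler (x : nat) (L : {set line F}) : Prop :=
  forall S : {set line F}, line_spread S -> #|L :&: S| = x.

Definition collineation (phi : {perm point F}) : Prop :=
  forall l, exists m, phi @: pts l = pts m.

Definition line_image (phi : {perm point F}) (L : {set line F}) : {set line F} :=
  [set m | [exists l in L, pts m == phi @: pts l]].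

Definition equivalent (L M : {set line F}) : Prop :=
  exists2 phi : {perm point F}, collineation phi & line_image phi L = M.

End Geometry.

Section LineClasses.

Variable F : finFieldType.

(* 0 counts as a square. *)
Definition square (a : F) : bool := [exists b : F, a == b ^+ 2].
Definition nonzero_square (a : F) : bool := (a != 0) && square a.
Definition nonsquare (a : F) : bool := ~~ square a.

(* The points having a homogeneous coordinate vector that satisfies A.  All the
   predicates A used below are invariant under multiplication of the vector by
   a non-zero scalar. *)
Definition points_where (A : pred 'rV[F]_4) : {set point F} :=
  [set P : point F | [exists v : 'rV[F]_4, [&& v != 0, v \in subsp_val P & A v]]].

Definition X1 (v : 'rV[F]_4) : F := v 0 (inord 0).
Definition X2 (v : 'rV[F]_4) : F := v 0 (inord 1).
Definition X3 (v : 'rV[F]_4) : F := v 0 (inord 2).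
Definition X4 (v : 'rV[F]_4) : F := v 0 (inord 3).

Variables w l1 l2 : F.

Definition Qform (v : 'rV[F]_4) : F :=
  X1 v ^+ 2 - w * X2 v ^+ 2 + X3 v * X4 v.

Definition Elam (lam : F) : {set point F} :=
  points_where (fun v =>
    X1 v ^+ 2 - w * X2 v ^+ 2 + lam * X4 v ^+ 2 + X3 v * X4 v == 0).

Definition E : {set point F} := Elam 0.

Definition Os : {set point F} := points_where (fun v => nonzero_square (Qform v)).
Definition On : {set point F} := points_where (fun v => nonsquare (Qform v)).

Definition L0 : {set line F} :=
  [set r | (#|pts r :&: E| == 1%N) && (pts r :\: E \subset Os)].
Definition L2 : {set line F} := [set r | #|pts r :&: E| == 2].
Definition L3 : {set line F} := [set r | pts r :&: E == set0].

Definition planeX4 : {set point F} := points_where (fun v => X4 v == 0).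
Definition pi0 : {set point F} := planeX4 :&: Os.
Definition pi1 : {set point F} := planeX4 :&: On.

Definition U3 : 'rV[F]_4 := delta_mx 0 (inord 2).

Definition tangent_meeting (lam : F) (A : {set point F}) (L : {set line F}) :
    {set line F} :=
  [set r in L | (#|pts r :&: Elam lam| == 1%N) && (#|pts r :&: A| == 1%N)].

Definition T10 : {set line F} := tangent_meeting l1 pi0 L2.
Definition T11 : {set line F} := tangent_meeting l1 pi1 L3.
Definition T20 : {set line F} := tangent_meeting l2 pi0 L3.
Definition T21 : {set line F} := tangent_meeting l2 pi1 L2.

Definition setA : {set line F} := T11 :|: T20.
Definition setB : {set line F} := T10 :|: T21.

Definition Lprime : {set line F} := L0 :|: L3.

Definition L3prime : {set line F} := [set r in L3 | pts r \subset planeX4].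
Definition L2prime : {set line F} := [set r in L2 | U3 \in subsp_val r].

Definition Lsecond : {set line F} := (Lprime :\: L3prime) :|: L2prime.

Definition Lthird : {set line F} := (Lprime :\: setA) :|: setB.

End LineClasses.

(* Main.v *)
Require Import Defs.
From mathcomp Require Import all_boot all_order all_fingroup all_algebra.
From mathcomp Require Import ring zify.

Set Implicit Arguments.
Unset Strict Implicit.
Unset Printing Implicit Defensive.
Import GRing.Theory.
Local Open Scope ring_scope.

(** The degree of a point with respect to a set of lines is the number of lines
    of the set through it; collineations preserve degrees.  The point
    [(0, 0, 0, 1)] of [E] has degree [5(q+1)/2] in [L''']: [(q+1)/2] tangents to
    [E] and [q+1] tangents to each of [E_l1], [E_l2].  In [L'] and [L''] the
    points of [E] have degree at most [(q+3)/2], except [U3] in [L''], whose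
    degree is at least [q^2], and all other points have degree at least
    [q(q-1)/2], which exceeds [5(q+1)/2] as soon as [q >= 7].  The classes
    containing a full star or a full plane are excluded because every point and
    every plane is incident with a line missing from [L''']: usually a secant of
    [E] through [U3], and otherwise a tangent to [E] outside [L0], a line of the
    set [A], or a secant of [E] tangent to neither [E_l1] nor [E_l2]. *)

(** * Squares in [F] and the norm form *)

Section NormForm.

Variables (F : finFieldType) (w : F).
Hypothesis q_odd : odd #|F|.

(** Translation by 1 permutes [F], so comparing sums over [F] shows that [q] times 1 vanishes; with
    [q] odd, [2 = 0] would then give [1 = 0]. *)
Lemma two_neq0 : (2 : F) != 0.
Proof.
apply/eqP => two0; have : (1 : F) *+ #|F| = 0.
  apply: (addrI (\sum_(x : F) x)); rewrite addr0.
  by rewrite -[1 *+ _]sumr_const -big_split /= [RHS](reindex_inj (addIr 1)).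
rewrite -(odd_double_half #|F|) q_odd mulrnDr -mul2n mulrnA two0 mul0rn addr0.
by move/eqP; rewrite oner_eq0.
Qed.

Lemma four_neq0 : (4 : F) != 0.
Proof. by rewrite (natrM _ 2 2) mulf_neq0 ?two_neq0. Qed.

(** Applied to the discriminant of a quadratic form on a line, these three cases separate tangents,
    secants and external lines. *)
Lemma card_sqrt (d : F) :
  #|[set u : F | u ^+ 2 == d]| =
    if d == 0 then 1%N else if square d then 2%N else 0%N.
Proof.
case: eqVneq => [->|dn0].
  by rewrite -(cards1 (0 : F)); congr #|pred_of_set _|; apply/setP => u;
     rewrite !inE expf_eq0.
case: ifPn => [/existsP[b /eqP db]|/existsPn sq].
  have bNb : b != - b.
    rewrite -subr_eq0 opprK -mulr2n -mulr_natl mulf_neq0 ?two_neq0 //.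
    by apply: contraNneq dn0 => b0; rewrite db b0 expr0n.
  transitivity #|[set b; - b]|; last by rewrite cards2 bNb.
  by congr #|pred_of_set _|; apply/setP => u; rewrite !inE db eqf_sqr.
apply/eqP; rewrite cards_eq0; apply/eqP/setP => u; rewrite !inE.
by apply/negbTE; rewrite eq_sym sq.
Qed.

Lemma card_sqrt_eq1 (d : F) : (#|[set u : F | u ^+ 2 == d]| == 1)%N = (d == 0).
Proof. by rewrite card_sqrt; case: (d == 0); case: (square d). Qed.

Lemma card_sqrt_eq0 (d : F) : (#|[set u : F | u ^+ 2 == d]| == 0)%N = nonsquare d.
Proof.
rewrite card_sqrt /nonsquare; case: (eqVneq d 0) => [->|_]; last by case: square.
by have -> : square (0 : F) by apply/existsP; exists 0; rewrite expr0n.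
Qed.

Lemma card_sqrt_eq2 (d : F) :
  (#|[set u : F | u ^+ 2 == d]| == 2)%N = nonzero_square d.
Proof.
by rewrite card_sqrt /nonzero_square; case: (d == 0); case: (square d).
Qed.

(** Squaring has one element over 0 and two over each non-zero square. *)
Lemma card_nonzero_square : (#|[set d : F | nonzero_square d]|).*2.+1 = #|F|.
Proof.
rewrite -[RHS]sum1_card (partition_big (fun u : F => u ^+ 2) predT) //=.
under eq_bigr => d _ do rewrite sum1dep_card card_sqrt.
rewrite (bigD1 0) //= eqxx add1n; congr _.+1.
rewrite -muln2 -sum1_card big_distrl /= big_mkcond /= [RHS]big_mkcond /=.
apply: eq_bigr => d _; rewrite inE /nonzero_square.
by case: eqVneq => //= _; case: square.
Qed.

Lemma square0 : square (0 : F).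
Proof. by apply/existsP; exists 0; rewrite expr0n. Qed.

Lemma card_nonsquare : (#|[set d : F | nonsquare d]|).*2.+1 = #|F|.
Proof.
have := card_nonzero_square.
have: (#|[set d : F | nonsquare d]| + #|[set d : F | square d]| = #|F|)%N.
  rewrite -(cardsC [set d : F | square d]) addnC; congr (_ + _)%N.
  by apply: eq_card => d; rewrite !inE.
have: #|[set d : F | square d]| = #|[set d : F | nonzero_square d]|.+1.
  rewrite (cardsD1 0) inE square0 add1n; congr _.+1.
  by apply: eq_card => d; rewrite !inE.
lia.
Qed.

Lemma nonsquare_neq0 (a : F) : nonsquare a -> a != 0.
Proof. by apply: contraNneq => ->; rewrite square0. Qed.

Lemma squareMl (a b : F) : a != 0 -> square (a ^+ 2 * b) = square b.
Proof.
move=> a0; apply/existsP/existsP => [[u /eqP e]|[u /eqP ->]]; last first.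
  by exists (a * u); rewrite exprMn.
by exists (u / a); rewrite expr_div_n -e mulrC mulKf ?expf_neq0.
Qed.

Hypothesis w_nonsquare : nonsquare w.

(** The norm of [x.1 + x.2 sqrt(w)] from GF(q^2) down to [F]. *)
Definition nrm (x : F * F) : F := x.1 ^+ 2 - w * x.2 ^+ 2.

Lemma nrm_eq0 x : (nrm x == 0) = (x == (0, 0)).
Proof.
apply/idP/eqP => [|->]; last by rewrite /nrm /= !expr0n mulr0 subrr.
case: x => a b; rewrite /nrm subr_eq0 /= => /eqP e.
have b0 : b = 0.
  apply: contraNeq w_nonsquare => b0; apply/existsP; exists (a / b).
  by rewrite expr_div_n e mulfK ?expf_neq0.
by move/eqP: e; rewrite b0 expr0n mulr0 expf_eq0 /= => /eqP ->.
Qed.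

(** Pigeonhole: the set of squares and its image under [d |-> c + w d] both have [(q+1)/2] elements,
    so they meet. *)
Lemma nrm_surj (c : F) : exists x, nrm x = c.
Proof.
pose A := [set d : F | square d]; pose B := [set c + w * d | d in A].
have cB : #|B| = #|A|.
  apply: card_imset => d d' /addrI /mulfI; apply; exact: nonsquare_neq0.
have cA : (#|A|).*2 = #|F|.+1.
  have : (#|A| + #|[set d : F | nonsquare d]| = #|F|)%N.
    by rewrite -(cardsC A); congr addn; apply: eq_card => d; rewrite !inE.
  by have := card_nonsquare; lia.
have : A :&: B != set0.
  rewrite -card_gt0.
  have := cardsUI A B; have : (#|A :|: B| <= #|F|)%N := max_card _.
  by rewrite cB; lia.
case/set0Pn => _ /setIP[/[swap] /imsetP[d + ->]].
rewrite !inE => /existsP[b /eqP ->] /existsP[a /eqP e].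
by exists (a, b); rewrite /nrm /= -e addrK.
Qed.

(** Multiplication in GF(q^2) by an element of norm [d / c], which is [f] below, maps one fibre
    injectively into the other. *)
Lemma nrm_fiber_le (c d : F) : c != 0 -> d != 0 ->
  (#|[set x | nrm x == c]| <= #|[set x | nrm x == d]|)%N.
Proof.
move=> c0 d0; have [[a b] ab] := nrm_surj (d / c); rewrite /nrm /= in ab.
have n0 : a ^+ 2 - w * b ^+ 2 != 0 by rewrite ab mulf_neq0 ?invr_eq0.
pose f (x : F * F) := (x.1 * a + w * x.2 * b, x.1 * b + x.2 * a).
have f_inj : injective f.
  apply: (can_inj (g := fun x => ((x.1 * a - w * x.2 * b) / (a ^+ 2 - w * b ^+ 2),
                                 (x.2 * a - x.1 * b) / (a ^+ 2 - w * b ^+ 2)))).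
  by move=> [x y]; rewrite /f /=; congr pair; field.
rewrite -(card_imset _ f_inj); apply/subset_leq_card/subsetP => _ /imsetP[[x y] + ->].
rewrite !inE => /eqP nx; apply/eqP.
transitivity (nrm (x, y) * (a ^+ 2 - w * b ^+ 2)); first by rewrite /nrm /f /=; ring.
by rewrite nx ab mulrC divfK.
Qed.

(** The [q - 1] fibres over non-zero values have equal size and, with the single pair over 0,
    exhaust the [q^2] pairs; the size is [(q^2 - 1)/(q - 1)]. *)
Lemma card_nrm (c : F) : c != 0 -> #|[set x | nrm x == c]| = #|F|.+1.
Proof.
move=> c0.
have nE (d : F) : d != 0 -> #|[set x | nrm x == d]| = #|[set x | nrm x == c]|.
  by move=> d0; apply/eqP; rewrite eqn_leq !nrm_fiber_le.
have : (#|F| * #|F|)%N = (\sum_d #|[set x | nrm x == d]|)%N.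
  rewrite -card_prod -sum1_card (partition_big nrm predT) //=.
  by apply: eq_bigr => d _; rewrite sum1dep_card.
rewrite (bigD1 0) //= (eq_bigr _ nE) sum_nat_const cardC1.
have -> : [set x | nrm x == 0] = [set (0, 0)] by apply/setP => x; rewrite !inE nrm_eq0.
rewrite cards1; case: #|F| (card_finNzRing_gt1 F) => [|[|n]] // _.
set k := #|_| => /= e; apply/eqP.
by rewrite -(eqn_pmul2l (ltn0Sn n)); apply/eqP; lia.
Qed.

End NormForm.

(** * Coordinates, points and lines of PG(3,q) *)

Section Space.

Variable F : finFieldType.
Implicit Types (p u v : 'rV[F]_4) (P : point F) (l : line F) (L : {set line F}).

Definition vec (a b c d : F) : 'rV[F]_4 := \row_(i < 4) [:: a; b; c; d]`_i.

Lemma X1_vec a b c d : X1 (vec a b c d) = a.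
Proof. by rewrite /X1 mxE inordK. Qed.
Lemma X2_vec a b c d : X2 (vec a b c d) = b.
Proof. by rewrite /X2 mxE inordK. Qed.
Lemma X3_vec a b c d : X3 (vec a b c d) = c.
Proof. by rewrite /X3 mxE inordK. Qed.
Lemma X4_vec a b c d : X4 (vec a b c d) = d.
Proof. by rewrite /X4 mxE inordK. Qed.
Definition X_vec := (X1_vec, X2_vec, X3_vec, X4_vec).

Lemma X1_lin a b u v : X1 (a *: u + b *: v) = a * X1 u + b * X1 v.
Proof. by rewrite /X1 !mxE. Qed.
Lemma X2_lin a b u v : X2 (a *: u + b *: v) = a * X2 u + b * X2 v.
Proof. by rewrite /X2 !mxE. Qed.
Lemma X3_lin a b u v : X3 (a *: u + b *: v) = a * X3 u + b * X3 v.
Proof. by rewrite /X3 !mxE. Qed.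
Lemma X4_lin a b u v : X4 (a *: u + b *: v) = a * X4 u + b * X4 v.
Proof. by rewrite /X4 !mxE. Qed.
Definition X_lin := (X1_lin, X2_lin, X3_lin, X4_lin).

Lemma vecP u v : X1 u = X1 v -> X2 u = X2 v -> X3 u = X3 v -> X4 u = X4 v -> u = v.
Proof.
move=> h1 h2 h3 h4; apply/rowP => i; rewrite -(inord_val i).
by case: i => [[|[|[|[|]]]]] //= _.
Qed.

Lemma XZ k v : (X1 (k *: v) = k * X1 v) * (X2 (k *: v) = k * X2 v) *
  (X3 (k *: v) = k * X3 v) * (X4 (k *: v) = k * X4 v).
Proof. by rewrite /X1 /X2 /X3 /X4 !mxE. Qed.

Lemma X0 : (X1 (0 : 'rV[F]_4) = 0) * (X2 (0 : 'rV[F]_4) = 0) *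
  (X3 (0 : 'rV[F]_4) = 0) * (X4 (0 : 'rV[F]_4) = 0).
Proof. by rewrite /X1 /X2 /X3 /X4 !mxE. Qed.

Lemma U3E : U3 F = vec 0 0 1 0.
Proof.
by apply: vecP; rewrite X_vec /X1 /X2 /X3 /X4 /U3 mxE eqxx -val_eqE /= !inordK.
Qed.

Definition indep p v := (p != 0) && (v \notin <[p]>%VS).

Lemma indep_eq p v a b a' b' : indep p v ->
  a *: p + b *: v = a' *: p + b' *: v -> a = a' /\ b = b'.
Proof.
move=> /andP[p0 pv] e.
have e' : (b - b') *: v = (a' - a) *: p.
  rewrite !scalerBl; apply/eqP; rewrite subr_eq addrAC -subr_eq opprK.
  by rewrite [X in X == _]addrC e addrC.
have bb : b = b'.
  apply: contraNeq pv; rewrite -subr_eq0 => b0; apply/vlineP.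
  exists ((b - b')^-1 * (a' - a)).
  by rewrite -scalerA -e' scalerA mulVf ?scale1r.
split=> //; move: e'; rewrite bb subrr scale0r => /esym/eqP.
by rewrite scaler_eq0 (negbTE p0) orbF subr_eq0 => /eqP.
Qed.

Lemma indepP p v : (forall a b, a *: p + b *: v = 0 -> a = 0 /\ b = 0) ->
  indep p v.
Proof.
move=> h; apply/andP; split.
  apply/eqP => p0; have [] := h 1 0; first by rewrite p0 scaler0 scale0r addr0.
  by move/eqP; rewrite oner_eq0.
apply/vlineP => -[k vE]; have [] := h k (-1).
  by rewrite vE scaleN1r subrr.
by move=> _ /eqP; rewrite oppr_eq0 oner_eq0.
Qed.

Lemma indep_sym p v : indep p v -> indep v p.
Proof.
move=> i; apply: indepP => a b e.
have [] := @indep_eq p v b a 0 0 i; first by rewrite addrC e !scale0r addr0.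
by [].
Qed.

Lemma dim_join p v : indep p v -> \dim (<[p]> + <[v]>)%VS = 2.
Proof.
move=> /andP[p0 pv]; rewrite dimv_disjoint_sum ?dim_vline ?p0.
  by case: eqVneq pv => // ->; rewrite mem0v.
apply/eqP; rewrite -subv0; apply/subvP => u; rewrite memv_cap memv0.
case/andP => up /vlineP[k uE]; apply: contraNT pv => u0.
have k0 : k != 0 by apply: contraNneq u0 => k0; rewrite uE k0 scale0r.
by rewrite -(scalerK k0 v) -uE memvZ.
Qed.

Lemma mem_joinP p v u :
  reflect (exists a b, u = a *: p + b *: v) (u \in (<[p]> + <[v]>)%VS).
Proof.
apply: (iffP memv_addP) => [[x /vlineP[a ->] [y /vlineP[b ->] ->]]|].
  by exists a, b.
case=> a [b ->]; exists (a *: p); first by rewrite memvZ ?memv_line.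
by exists (b *: v); rewrite // memvZ ?memv_line.
Qed.

Lemma mem_joinl p v : p \in (<[p]> + <[v]>)%VS.
Proof. by apply/mem_joinP; exists 1, 0; rewrite scale1r scale0r addr0. Qed.

Lemma mem_joinr p v : v \in (<[p]> + <[v]>)%VS.
Proof. by apply/mem_joinP; exists 0, 1; rewrite scale1r scale0r add0r. Qed.

Lemma line_through p v : indep p v ->
  exists l : line F, subsp_val l = (<[p]> + <[v]>)%VS.
Proof. by move=> /dim_join/eqP d; exists (Subsp d). Qed.

Lemma line_join l p v : p \in subsp_val l -> v \in subsp_val l -> indep p v ->
  subsp_val l = (<[p]> + <[v]>)%VS.
Proof.
move=> pl vl i; apply/eqP; rewrite eq_sym eqEdim dim_join // (eqP (subsp_dim l)).
by rewrite subv_add -!memvE pl vl.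
Qed.

Lemma pointP P : exists2 v, v != 0 & subsp_val P = <[v]>%VS.
Proof.
case: P => U /= dU; exists (vpick U).
  by rewrite vpick0 -dimv_eq0 (eqP dU).
apply/eqP; rewrite eq_sym eqEdim -memvE memv_pick (eqP dU) dim_vline.
by rewrite vpick0 -dimv_eq0 (eqP dU).
Qed.

Lemma point_of v : v != 0 -> exists P : point F, subsp_val P = <[v]>%VS.
Proof.
move=> v0; have d : \dim <[v]> == 1%N by rewrite dim_vline v0.
by exists (Subsp d).
Qed.

Lemma vlineZ k v : k != 0 -> <[k *: v]>%VS = <[v]>%VS.
Proof.
move=> k0; apply/eqP; rewrite eqEsubv -!memvE memvZ ?memv_line //=.
by rewrite -{1}(scalerK k0 v) memvZ ?memv_line.
Qed.

Lemma in_pts_vline P l v : subsp_val P = <[v]>%VS ->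
  (P \in pts l) = (v \in subsp_val l).
Proof. by move=> e; rewrite inE e -memvE. Qed.

Definition homogeneous (A : pred 'rV[F]_4) :=
  forall k v, k != 0 -> A (k *: v) = A v.

(** [points_where] asks for one suitable vector; under homogeneity all non-zero vectors of a point
    agree, so any spanning vector decides. *)
Lemma in_points_where A P v : homogeneous A -> v != 0 ->
  subsp_val P = <[v]>%VS -> (P \in points_where A) = A v.
Proof.
move=> hA v0 e; rewrite inE; apply/existsP/idP => [[u /and3P[u0]]|Av].
  rewrite e => /vlineP[k uE]; rewrite uE hA //.
  by apply: contraNneq u0 => k0; rewrite uE k0 scale0r.
by exists v; rewrite v0 e memv_line.
Qed.

Lemma pts_inj : injective (@pts F).
Proof.
move=> l m e; apply/val_inj/vspaceP => v.
have [->|v0] := eqVneq v 0; first by rewrite !mem0v.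
by have [P Pv] := point_of v0; rewrite -!(in_pts_vline _ Pv) e.
Qed.

End Space.

(** * Intersections of lines with the quadrics [Elam] *)

Section Quadrics.

Variables (F : finFieldType) (w : F).
Implicit Types (p u v : 'rV[F]_4) (P : point F) (l : line F) (lam : F).

Definition Ql lam v :=
  X1 v ^+ 2 - w * X2 v ^+ 2 + lam * X4 v ^+ 2 + X3 v * X4 v.

(** The polar form of [Ql lam]. *)
Definition Bl lam u v := 2 * X1 u * X1 v - 2 * w * X2 u * X2 v
  + 2 * lam * X4 u * X4 v + (X3 u * X4 v + X4 u * X3 v).

Lemma Ql_lin lam a b u v : Ql lam (a *: u + b *: v) =
  a ^+ 2 * Ql lam u + a * b * Bl lam u v + b ^+ 2 * Ql lam v.
Proof. rewrite /Ql /Bl !X_lin; ring. Qed.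

Lemma QlZ lam k v : Ql lam (k *: v) = k ^+ 2 * Ql lam v.
Proof. rewrite /Ql !XZ; ring. Qed.

Lemma Qform0 v : Qform w v = Ql 0 v.
Proof. rewrite /Qform /Ql; ring. Qed.

Lemma in_Elam lam P v : v != 0 -> subsp_val P = <[v]>%VS ->
  (P \in Elam w lam) = (Ql lam v == 0).
Proof.
apply: in_points_where => k u k0; rewrite -!/(Ql _ _) QlZ mulf_eq0 expf_eq0 /=.
by rewrite (negbTE k0).
Qed.

Lemma in_Os P v : v != 0 -> subsp_val P = <[v]>%VS ->
  (P \in Os w) = nonzero_square (Ql 0 v).
Proof.
rewrite -Qform0; apply: in_points_where => k u k0; rewrite !Qform0 QlZ.
by rewrite /nonzero_square squareMl // mulf_eq0 expf_eq0 /= (negbTE k0).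
Qed.

Lemma in_planeX4 P v : v != 0 -> subsp_val P = <[v]>%VS ->
  (P \in planeX4 F) = (X4 v == 0).
Proof.
apply: in_points_where => k u k0; rewrite XZ mulf_eq0 (negbTE k0) //.
Qed.

Hypothesis q_odd : odd #|F|.

(** As [p] is off the quadric, the points of the line on it are [t p + v] with [t] a root of a
    quadratic polynomial; [u = 2 t Q(p) + B(p, v)] then runs over the square roots of its
    discriminant. *)
Lemma card_line_Elam lam l p v : subsp_val l = (<[p]> + <[v]>)%VS ->
  indep p v -> Ql lam p != 0 ->
  #|pts l :&: Elam w lam| =
  #|[set u : F | u ^+ 2 == Bl lam p v ^+ 2 - 4 * Ql lam p * Ql lam v]|.
Proof.
move=> lE i Qp0; have t0 := two_neq0 q_odd.
pose f (u : F) := <[((u - Bl lam p v) / (2 * Ql lam p)) *: p + 1 *: v]>%VS.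
have n0 c : c *: p + 1 *: v != 0.
  apply/eqP => e; have [] := @indep_eq _ p v c 1 0 0 i.
    by rewrite e !scale0r addr0.
  by move=> _ /eqP; rewrite oner_eq0.
have f_inj : injective f.
  move=> a b e; have := memv_line (((a - Bl lam p v) / (2 * Ql lam p)) *: p + 1 *: v).
  rewrite -/(f a) e => /vlineP[k]; rewrite scalerDr !scalerA.
  case/(indep_eq i) => + /esym; rewrite mulr1 => /[swap] ->; rewrite mul1r.
  by move=> /mulIf; rewrite invr_eq0 mulf_neq0 // => /(_ isT)/addIr.
rewrite -(card_imset _ f_inj) -(card_imset _ val_inj).
apply: eq_card => U; apply/imsetP/imsetP => [[P + ->]|[u + ->]].
  rewrite inE => /andP[]; have [x x0 Px] := pointP P.
  rewrite (in_pts_vline _ Px) (in_Elam _ x0 Px) lE => /mem_joinP[a [b xE]].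
  rewrite xE Ql_lin => /eqP Q0.
  have b0 : b != 0.
    apply: contraNneq x0 => b0; move/eqP: Q0.
    rewrite xE b0 expr0n mulr0 !mul0r !addr0 mulf_eq0 (negbTE Qp0) orbF expf_eq0 /=.
    by move=> /eqP ->; rewrite !scale0r addr0.
  exists (2 * Ql lam p * (a / b) + Bl lam p v).
    rewrite inE -subr_eq0; apply/eqP.
    transitivity (4 * Ql lam p / b ^+ 2 * (a ^+ 2 * Ql lam p + a * b * Bl lam p v +
      b ^+ 2 * Ql lam v)); last by rewrite Q0 mulr0.
    by field.
  rewrite /f addrK mulrC mulKf ?mulf_neq0 // /= Px -(vlineZ _ b0).
  by rewrite scalerDr !scalerA mulr1 mulrCA divff // mulr1 -xE.
rewrite inE => /eqP uE; have [P Pv] := point_of (n0 ((u - Bl lam p v) / (2 * Ql lam p))).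
exists P; last by rewrite [RHS]Pv.
rewrite inE (in_pts_vline _ Pv) (in_Elam _ (n0 _) Pv) lE; apply/andP; split.
  by apply/mem_joinP; do 2!eexists.
rewrite Ql_lin; apply/eqP.
transitivity ((u ^+ 2 - (Bl lam p v ^+ 2 - 4 * Ql lam p * Ql lam v)) / (4 * Ql lam p)).
  have f0 := four_neq0 q_odd; by field; rewrite Qp0 f0.
by rewrite uE subrr mul0r.
Qed.

End Quadrics.

(** Each fibre of [f] in [A] contains some [x] together with [g x], hence at least two elements. *)
Lemma card_imset_half (T U : finType) (f : T -> U) (g : T -> T) (A : {set T}) :
  (forall x, x \in A -> [/\ g x \in A, g x != x & f (g x) = f x]) ->
  ((#|f @: A|).*2 <= #|A|)%N.
Proof.
move=> h; rewrite -[#|A|]sum1_card (partition_big_imset f) /= -muln2.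
rewrite -sum_nat_const; apply: leq_sum => y /imsetP[x xA ->].
rewrite sum1dep_card; have [gA gx fg] := h _ xA.
rewrite -[X in (X <= _)%N](_ : #|[set x; g x]| = _); last by rewrite cards2 eq_sym gx.
apply/subset_leq_card/subsetP => z; rewrite !inE => /orP[]/eqP->.
  by rewrite xA eqxx.
by rewrite gA fg eqxx.
Qed.

(** * Counting the lines of a set through a point *)

Section Stars.

Variables (F : finFieldType).
Implicit Types (p u v : 'rV[F]_4) (P : point F) (l : line F) (L M : {set line F}).

Definition deg L P := #|L :&: lines_through P|.

Lemma in_lines_through P l p : subsp_val P = <[p]>%VS ->
  (l \in lines_through P) = (p \in subsp_val l).
Proof. by move=> e; rewrite inE e -memvE. Qed.

Lemma degS L M P : {subset L <= M} -> (deg L P <= deg M P)%N.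
Proof. by move=> /subsetP h; apply/subset_leq_card/setSI. Qed.

Lemma degU L M P : (deg (L :|: M) P <= deg L P + deg M P)%N.
Proof. by rewrite /deg setIUl leq_card_setU. Qed.

(** By the last hypothesis [f x] lies on the join of [p] and [f y] only if [x = y], so the joins are
    pairwise distinct. *)
Lemma deg_ge (T : finType) (A : {set T}) (f : T -> 'rV[F]_4) L P p :
  subsp_val P = <[p]>%VS ->
  (forall x, x \in A -> indep p (f x)) ->
  (forall x l, x \in A -> subsp_val l = (<[p]> + <[f x]>)%VS -> l \in L) ->
  (forall x y a b, x \in A -> y \in A -> f x = a *: p + b *: f y -> x = y) ->
  (#|A| <= deg L P)%N.
Proof.
move=> Pp ind inL inj; pose g x := (<[p]> + <[f x]>)%VS.
have g_inj : {in A &, injective g}.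
  move=> x y xA yA e; have : f x \in g x by rewrite mem_joinr.
  by rewrite e => /mem_joinP[a [b /inj]]; apply.
rewrite -(card_in_imset g_inj) -[X in (_ <= X)%N](card_imset _ val_inj).
apply/subset_leq_card/subsetP => _ /imsetP[x xA ->].
have [l lE] := line_through (ind _ xA).
apply/imsetP; exists l; last by rewrite [RHS]lE.
by rewrite inE (inL _ _ xA lE) (in_lines_through _ Pp) lE mem_joinl.
Qed.

(** The bound counts joins rather than elements of [A], so that coincidences among joins can sharpen
    it. *)
Lemma deg_le (T : finType) (A : {set T}) (f : T -> 'rV[F]_4) L P p :
  subsp_val P = <[p]>%VS ->
  (forall l, l \in L -> p \in subsp_val l ->
    exists x, [/\ x \in A, f x \in subsp_val l & indep p (f x)]) ->
  (deg L P <= #|[set (<[p]> + <[f x]>)%VS | x in A]|)%N.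
Proof.
move=> Pp h; rewrite /deg -(card_imset _ val_inj).
apply/subset_leq_card/subsetP => _ /imsetP[l /setIP[lL lP] ->].
rewrite (in_lines_through _ Pp) in lP; have [x [xA xl ind]] := h l lL lP.
by apply/imsetP; exists x => //; apply: line_join.
Qed.

Lemma line_ext l p : p != 0 -> p \in subsp_val l ->
  exists2 v, v \in subsp_val l & indep p v.
Proof.
move=> p0 pl; have /subvPn[v vl vp] : ~~ (l <= <[p]>)%VS.
  apply/negP => /dimvS; rewrite (eqP (subsp_dim l)) dim_vline p0.
  by [].
by exists v; rewrite // /indep p0.
Qed.

Lemma indep_X4 p v : X4 p != 0 -> v != 0 -> X4 v = 0 -> indep p v.
Proof.
move=> p4 v0 v4; apply/andP; split; first by apply: contraNneq p4 => ->; rewrite X0.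
apply: contra v0 => /vlineP[k vE]; move: v4; rewrite vE XZ => /eqP.
by rewrite mulf_eq0 (negbTE p4) orbF => /eqP ->; rewrite scale0r.
Qed.

Lemma line_meets_X4 l p : p \in subsp_val l -> X4 p != 0 ->
  exists v, [/\ v \in subsp_val l, v != 0 & X4 v = 0].
Proof.
move=> pl p4; have p0 : p != 0 by apply: contraNneq p4 => ->; rewrite X0.
have [v vl i] := line_ext p0 pl.
exists (1 *: v + (- (X4 v / X4 p)) *: p); split.
- by rewrite memvD ?memvZ.
- apply/eqP => e; have [] := @indep_eq _ v p 1 (- (X4 v / X4 p)) 0 0.
  + exact: indep_sym.
  + by rewrite e !scale0r addr0.
  + by move/eqP; rewrite oner_eq0.
- by rewrite X4_lin mul1r mulNr divfK // subrr.
Qed.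

End Stars.

(** * Tangents, secants and external lines of [E] *)

Section Counts.

Variables (F : finFieldType) (w : F).
Hypothesis q_odd : odd #|F|.
Hypothesis w_nonsquare : nonsquare w.
Implicit Types (p u v : 'rV[F]_4) (P : point F) (l : line F) (lam : F).

Lemma nrm0 (a b : F) : a ^+ 2 - w * b ^+ 2 = 0 -> a = 0 /\ b = 0.
Proof. by move/eqP; rewrite -[_ - _]/(nrm w (a, b)) nrm_eq0 // => /eqP[-> ->]. Qed.

(** The norm form being anisotropic, all the quadrics thus meet the plane [X4 = 0] in the point [U3]
    alone. *)
Lemma Ql_X4 lam v : X4 v = 0 -> Ql w lam v = nrm w (X1 v, X2 v).
Proof. by rewrite /Ql /nrm /= => ->; ring. Qed.

Lemma in_L3 l p v : subsp_val l = (<[p]> + <[v]>)%VS -> indep p v ->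
  Ql w 0 p != 0 ->
  (l \in L3 w) = nonsquare (Bl w 0 p v ^+ 2 - 4 * Ql w 0 p * Ql w 0 v).
Proof.
move=> lE i Q0.
by rewrite inE -cards_eq0 (card_line_Elam q_odd lE) // card_sqrt_eq0.
Qed.

Lemma in_L2 l p v : subsp_val l = (<[p]> + <[v]>)%VS -> indep p v ->
  Ql w 0 p != 0 ->
  (l \in L2 w) = nonzero_square (Bl w 0 p v ^+ 2 - 4 * Ql w 0 p * Ql w 0 v).
Proof.
by move=> lE i Q0; rewrite inE (card_line_Elam q_odd lE) // card_sqrt_eq2.
Qed.

Lemma tangent_Elam lam l p v : subsp_val l = (<[p]> + <[v]>)%VS -> indep p v ->
  Ql w lam p != 0 ->
  (#|pts l :&: Elam w lam| == 1)%N =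
  (Bl w lam p v ^+ 2 == 4 * Ql w lam p * Ql w lam v).
Proof.
move=> lE i Q0.
by rewrite (card_line_Elam q_odd lE) // card_sqrt_eq1 // subr_eq0.
Qed.

Lemma L3_anisotropic l v : l \in L3 w -> v \in subsp_val l -> v != 0 ->
  Ql w 0 v != 0.
Proof.
rewrite inE => /eqP lE vl v0; have [P Pv] := point_of v0.
rewrite -(in_Elam w 0 v0 Pv); apply/negP => PE.
by have := in_set0 P; rewrite -lE inE PE (in_pts_vline _ Pv) vl.
Qed.

(** [p] is the only point of [E] on the line, so [v] is off [E]; the discriminant, which is
    [B(p, v)^2] because [Q(p) = 0], vanishes. *)
Lemma L0_through l p v : l \in L0 w -> p \in subsp_val l -> Ql w 0 p = 0 ->
  v \in subsp_val l -> indep p v ->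
  Bl w 0 p v = 0 /\ nonzero_square (Ql w 0 v).
Proof.
rewrite inE => /andP[c1 lS] pl Qp vl i.
have i' := indep_sym i.
have p0 : p != 0 by case/andP: i.
have v0 : v != 0 by case/andP: i'.
have [P Pp] := point_of p0; have [R Rv] := point_of v0.
have Pl : P \in pts l :&: E w.
  by rewrite inE (in_pts_vline _ Pp) pl (in_Elam _ _ p0 Pp) Qp eqxx.
have RE : R \notin E w.
  apply/negP => RE; case/cards1P: (c1) => S SE.
  have : R \in pts l :&: E w by rewrite inE (in_pts_vline _ Rv) vl.
  move: Pl; rewrite SE !inE => /eqP PS /eqP RS.
  by case/andP: i => _; rewrite -Pp PS -RS Rv memv_line.
split; last first.
  rewrite -(in_Os w v0 Rv); apply: (subsetP lS).
  by rewrite inE RE (in_pts_vline _ Rv) vl.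
have lE := line_join vl pl i'.
move: RE; rewrite (in_Elam _ _ v0 Rv) => Q0.
move: c1; rewrite (tangent_Elam lE) // Qp mulr0 expf_eq0 /= => /eqP.
by rewrite /Bl => e; rewrite -[RHS]e; ring.
Qed.

Lemma secant_U3 lam l v : v \in subsp_val l -> U3 F \in subsp_val l ->
  X4 v != 0 -> #|pts l :&: Elam w lam| = 2.
Proof.
rewrite U3E => vl ul v4.
(* Adding [t U3] to [v] adds [t X4(v)] to its form value. This [t] makes the value [X4(v)^2], so
   [v'] is off the quadric, and the discriminant is again [X4(v)^2]. *)
pose v' := 1 *: v + (X4 v - Ql w lam v / X4 v) *: vec 0 0 1 0.
have v'4 : X4 v' = X4 v by rewrite X4_lin X_vec; ring.
have Qv' : Ql w lam v' = X4 v ^+ 2.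
  by rewrite Ql_lin /Bl /Ql !X_vec; field.
have i : indep v' (vec 0 0 1 0).
  apply: indep_X4; rewrite ?v'4 ?X_vec //; apply/eqP => /(congr1 (@X3 F)).
  by rewrite X_vec X0 => /eqP; rewrite oner_eq0.
have lE : subsp_val l = (<[v']> + <[(vec 0 0 1 0)%R]>)%VS.
  by apply: line_join => //; rewrite memvD ?memvZ.
have Q0 : Ql w lam v' != 0 by rewrite Qv' expf_neq0.
rewrite (card_line_Elam q_odd lE i Q0); apply/eqP; rewrite card_sqrt_eq2 //.
rewrite [X in nonzero_square X](_ : _ = X4 v ^+ 2 * 1); last first.
  by rewrite /Bl v'4 [Ql _ _ (vec _ _ _ _)]/Ql !X_vec; ring.
rewrite /nonzero_square mulr1 expf_neq0 //=.
by apply/existsP; exists (X4 v).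
Qed.

Lemma secant_U3_point lam l v : v \in subsp_val l -> v != 0 -> X4 v = 0 ->
  X1 v = 0 -> X2 v = 0 -> forall p, p \in subsp_val l -> X4 p != 0 ->
  #|pts l :&: Elam w lam| = 2.
Proof.
move=> vl v0 v4 v1 v2 p pl p4; apply: secant_U3 pl _ p4.
have v3 : X3 v != 0.
  by apply: contraNneq v0 => v3; apply/eqP/vecP; rewrite X0.
rewrite (_ : U3 F = (X3 v)^-1 *: v) ?memvZ //.
by apply: vecP; rewrite U3E XZ !X_vec ?v1 ?v2 ?v4 ?mulr0 ?mulVf.
Qed.

(** Each such line contains a vector of the shape [f] below, orthogonal to [p], whose norm is a
    non-zero square; it can be rescaled to norm 1. Of the [q+1] pairs of norm 1, opposite ones give
    the same line. *)
Lemma deg_L0_E p P : p != 0 -> subsp_val P = <[p]>%VS -> Ql w 0 p = 0 ->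
  ((deg (L0 w) P).*2 <= #|F|.+1)%N.
Proof.
move=> p0 Pp Qp.
(* For [p = U3] the last coordinate vanishes and the quotient below is [0]. *)
pose f (x : F * F) := vec x.1 x.2
  (- (2 * X1 p * x.1 - 2 * w * X2 p * x.2) / X4 p) 0.
rewrite -(card_nrm q_odd w_nonsquare (oner_neq0 F)).
set A := [set x | _].
apply: (@leq_trans (#|[set (<[p]> + <[f x]>)%VS | x in A]|).*2); last first.
  apply: (card_imset_half (g := fun x => (- x.1, - x.2))) => -[x y].
  rewrite !inE /= => /eqP nx.
  have fN : f (- x, - y) = (-1) *: f (x, y).
    by apply: vecP; rewrite XZ !X_vec /=; ring.
  split; first by rewrite -nx /nrm /= !sqrrN.
    apply/eqP => -[ex ey].
    have h (z : F) : - z = z -> z = 0.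
      move=> e; apply/eqP; rewrite -(mulrI_eq0 _ (lregP (two_neq0 q_odd))).
      by rewrite mulr_natl mulr2n -{1}e addNr.
    move: nx; rewrite (h _ ex) (h _ ey) /nrm /= !expr0n mulr0 subr0 => /esym/eqP.
    by rewrite oner_eq0.
  by rewrite fN vlineZ // oppr_eq0 oner_eq0.
rewrite leq_double; apply: (deg_le Pp) => l lL pl.
have [v [vl i vE]] : exists v, [/\ v \in subsp_val l, indep p v &
    v = f (X1 v, X2 v)].
  have [v vl i] := line_ext p0 pl; have [B0 _] := L0_through lL pl Qp vl i.
  (* Adding a multiple of [p] clears the last coordinate of [v]; when [p] is [U3] that coordinate is
     0 already and the third one is cleared. *)
  pose c := if X4 p == 0 then - (X3 v / X3 p) else - (X4 v / X4 p).
  have vl' : 1 *: v + c *: p \in subsp_val l by rewrite memvD ?memvZ.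
  have i' : indep p (1 *: v + c *: p).
    apply: indepP => a b e.
    have [] := @indep_eq _ p v (a + b * c) b 0 0 i.
      rewrite !scale0r addr0 -e scalerDr !scalerA mulr1 scalerDl.
      by rewrite -addrA [_ *: p + b *: v]addrC.
    by move=> + b0; rewrite b0 mul0r addr0.
  exists (1 *: v + c *: p); split=> //.
  have [B0' _] := L0_through lL pl Qp vl' i'.
  rewrite /c in B0' *; case: eqVneq B0' => p4 B0'.
    move: Qp; rewrite Ql_X4 // /nrm /= => /nrm0[p1 p2].
    have p3 : X3 p != 0.
      by apply: contraNneq p0 => p3; apply/eqP/vecP; rewrite X0.
    have v4 : X4 v = 0.
      apply: (mulfI p3); rewrite mulr0 -[RHS]B0 /Bl p1 p2 p4; ring.
    apply: vecP; rewrite X_vec ?X_lin //= ?p1 ?p2 ?v4 ?p4.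
      by rewrite invr0 mul1r mulNr divfK ?mulr0 ?subrr.
    by rewrite !mulr0 addr0.
  have v4 : X4 (1 *: v + - (X4 v / X4 p) *: p) = 0 by rewrite X4_lin; field.
  apply: vecP; rewrite X_vec //; apply: (mulIf p4); rewrite divfK //.
  apply/eqP; rewrite -subr_eq0 /=; apply/eqP; rewrite -[RHS]B0' /Bl v4; ring.
have [B0 /andP[Q0 /existsP[s /eqP QE]]] := L0_through lL pl Qp vl i.
have v4 : X4 v = 0 by rewrite vE X_vec.
rewrite Ql_X4 // in QE Q0.
have s0 : s != 0 by apply: contraNneq Q0 => s0; rewrite QE s0 expr0n.
have fE : f (s^-1 * X1 v, s^-1 * X2 v) = s^-1 *: v.
  by rewrite {3}vE; apply: vecP; rewrite XZ !X_vec /=; ring.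
exists (s^-1 * X1 v, s^-1 * X2 v); split.
- rewrite inE; apply/eqP; transitivity (s ^- 2 * nrm w (X1 v, X2 v)).
    by rewrite /nrm /=; field.
  by rewrite QE mulVf ?expf_neq0.
- by rewrite fE memvZ.
- rewrite fE; apply: indepP => a b e.
  have [|-> /eqP] := @indep_eq _ p v a (b * s^-1) 0 0 i.
    by rewrite -scalerA e !scale0r addr0.
  by rewrite mulf_eq0 invr_eq0 (negbTE s0) orbF => /eqP.
Qed.

End Counts.

(** * Degrees of points in [L'] and [L''] *)

Section Degrees.

Variables (F : finFieldType) (w : F).
Hypothesis q_odd : odd #|F|.
Hypothesis w_nonsquare : nonsquare w.
Implicit Types (p u v : 'rV[F]_4) (P : point F) (l : line F) (lam c : F).

(** The map [d |-> 1 - 4 c d] permutes [F], so it takes non-square values at [(q-1)/2] elements; 0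
    is not among them, as 1 is a square, and each is the norm of [q+1] pairs. *)
Lemma card_nonsquare_nrm c : c != 0 ->
  (#|[set x | nonsquare (1 - 4 * c * nrm w x)]|).*2 = (#|F|.+1 * #|F|.-1)%N.
Proof.
move=> c0; have c40 : 4 * c != 0 by rewrite mulf_neq0 ?four_neq0.
pose g (d : F) := 1 - 4 * c * d.
have g_inj : injective g by move=> x y /addrI/oppr_inj/(mulfI c40).
have gE : #|[set d | nonsquare (g d)]| = #|[set d : F | nonsquare d]|.
  rewrite -(card_imset _ g_inj); apply: eq_card => d.
  rewrite inE; apply/imsetP/idP => [[e + ->]|nd]; first by rewrite inE.
  have e : d = g ((1 - d) / (4 * c)) by rewrite /g mulrCA divff // mulr1 subKr.
  by exists ((1 - d) / (4 * c)); rewrite ?inE -?e.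
rewrite -sum1_card (partition_big (nrm w) (mem [set d | nonsquare (g d)])) /=;
  last by move=> x; rewrite !inE.
rewrite (eq_bigr (fun=> #|F|.+1)); last first.
  move=> d; rewrite inE => nd.
  have d0 : d != 0.
    apply: contraTneq nd => ->; rewrite /g mulr0 subr0 negbK.
    by apply/existsP; exists 1; rewrite expr1n.
  rewrite -(card_nrm q_odd w_nonsquare d0) sum1dep_card; apply: eq_card => x.
  by rewrite !inE; case: eqVneq => [->|]; rewrite ?andbT ?andbF.
rewrite sum_nat_const gE; have := card_nonsquare q_odd.
by case: #|F| => //= n [<-]; rewrite doubleMl mulnC.
Qed.

Lemma X4_neq0 p : X4 p != 0 -> p != 0.
Proof. by apply: contraNneq => ->; rewrite X0. Qed.

(** Every line through [p] meets [X4 = 0] in one point; the lines counted are those for which this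
    point is not orthogonal to [p]. *)
Lemma card_external_out p P (M : {set line F}) :
  X4 p = 1 -> subsp_val P = <[p]>%VS ->
  Ql w 0 p != 0 ->
  (forall l, l \in L3 w -> p \in subsp_val l -> l \in M) ->
  (#|F|.+1 * #|F|.-1 <= (deg M P).*2)%N.
Proof.
move=> p4 Pp Q0 inM; rewrite -(card_nonsquare_nrm Q0) leq_double.
(* The third coordinate is chosen to make [B(p, f x) = 1], so that the discriminant becomes
   [1 - 4 Q(p) nrm(x)]. *)
pose f (x : F * F) := vec x.1 x.2 (1 - 2 * X1 p * x.1 + 2 * w * X2 p * x.2) 0.
have Bf x : Bl w 0 p (f x) = 1 by rewrite /Bl !X_vec p4; ring.
have i x : indep p (f x).
  apply: indep_X4; rewrite ?X_vec ?p4 ?oner_eq0 //.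
  apply/eqP => f0; have : (1 : F) = 0 by rewrite -(Bf x) f0 /Bl !X0; ring.
  by move/eqP; rewrite oner_eq0.
apply: (deg_ge (f := f) Pp) => // [x l|x y a b _ _ e].
  rewrite inE => ns lE; apply: inM; last first.
    by rewrite lE mem_joinl.
  rewrite (in_L3 q_odd lE) // Bf expr1n (_ : Ql w 0 (f x) = nrm w x) //.
  by rewrite /Ql /nrm !X_vec; ring.
have a0 : a = 0.
  by have := congr1 (@X4 F) e; rewrite X4_lin !X_vec p4 mulr0 addr0 mulr1.
have b1 : b = 1.
  have := Bf x; rewrite e a0 scale0r add0r => <-; rewrite -[LHS]mulr1 -(Bf y).
  by rewrite /Bl !XZ; ring.
move: e; rewrite a0 b1 scale0r scale1r add0r => e.
have := congr1 (@X1 F) e; have := congr1 (@X2 F) e; rewrite !X_vec.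
by case: x y {e} => [? ?] [? ?] /= -> ->.
Qed.

(** Only lines leaving the plane [X4 = 0] are required to lie in [M], because [L''] drops the
    external lines inside this plane. *)
Lemma card_external_in p P (M : {set line F}) :
  X4 p = 0 -> subsp_val P = <[p]>%VS -> Ql w 0 p != 0 ->
  (forall l v, l \in L3 w -> p \in subsp_val l -> v \in subsp_val l ->
     X4 v = 1 -> l \in M) ->
  (#|F| * #|F|.-1 <= (deg M P).*2)%N.
Proof.
move=> p4 Pp Q0 inM; set c := Ql w 0 p in Q0.
have cE : c = X1 p ^+ 2 - w * X2 p ^+ 2 by rewrite /c /Ql p4; ring.
have c40 : 4 * c != 0 by rewrite mulf_neq0 ?four_neq0.
(* The first two coordinates are norm-orthogonal to those of [p]. Each line through [p] leaving the
   plane has exactly one such vector, and [B(p, f x) = X3(p)]. *)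
pose f (x : F * F) := vec (x.1 * (w * X2 p)) (x.1 * X1 p) x.2 1.
pose A := [set x : F * F |
  nonsquare (X3 p ^+ 2 - 4 * c * (x.2 - w * c * x.1 ^+ 2))].
have cA : (#|A|).*2 = (#|F| * #|F|.-1)%N.
  (* For a fixed first entry the discriminant is affine in the second with slope [-4c], so [g] is a
     bijection. *)
  pose g (x : F * F) := (x.1, X3 p ^+ 2 - 4 * c * (x.2 - w * c * x.1 ^+ 2)).
  pose g' (x : F * F) := (x.1, (X3 p ^+ 2 - x.2) / (4 * c) + w * c * x.1 ^+ 2).
  have gK : cancel g g'.
    move=> [x y]; rewrite /g /g' /=; congr pair.
    by rewrite subKr mulrC mulKf // subrK.
  have g'K : cancel g' g.
    move=> [x y]; rewrite /g /g' /=; congr pair.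
    by rewrite addrK mulrCA divff // mulr1 subKr.
  have -> : A = g @^-1: [set x | nonsquare x.2] by apply/setP => x; rewrite !inE.
  rewrite on_card_preimset; last by exists g' => x _.
  have -> : [set x : F * F | nonsquare x.2] = setX setT [set d | nonsquare d].
    by apply/setP => x; rewrite !inE.
  rewrite cardsX cardsT; have := card_nonsquare q_odd.
  by case: #|F| => //= n [<-]; rewrite doubleMr.
rewrite -cA leq_double.
have p0 : p != 0 by apply: contraNneq Q0 => p0; rewrite /c p0 /Ql !X0 !expr0n !mulr0
  !addr0 subr0.
have i x : indep p (f x).
  apply: indep_sym; apply: indep_X4 => //; by rewrite X_vec oner_eq0.
apply: (deg_ge (f := f) Pp) => // [x l|[s x] [t y] a b _ _ e].
  rewrite inE => ns lE; apply: (inM _ (f x)); last by rewrite X_vec.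
  - rewrite (in_L3 q_odd lE) //; move: ns; congr nonsquare.
    by rewrite -/c /Bl /Ql !X_vec cE p4; ring.
  - by rewrite lE mem_joinl.
  - by rewrite lE mem_joinr.
have b1 : b = 1.
  by have := congr1 (@X4 F) e; rewrite X4_lin !X_vec p4 mulr0 add0r mulr1.
have e1 := congr1 (@X1 F) e; have e2 := congr1 (@X2 F) e; have e3 := congr1 (@X3 F) e.
rewrite X1_lin !X_vec /= b1 mul1r in e1.
rewrite X2_lin !X_vec /= b1 mul1r in e2.
rewrite X3_lin !X_vec /= b1 mul1r in e3.
have st : s = t.
  apply/eqP; rewrite -subr_eq0 -(mulrI_eq0 _ (lregP Q0)) cE; apply/eqP.
  have -> : (X1 p ^+ 2 - w * X2 p ^+ 2) * (s - t) =
    X1 p * (s * X1 p) - X2 p * (s * (w * X2 p)) - t * (X1 p ^+ 2 - w * X2 p ^+ 2).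
    ring.
  rewrite e1 e2; ring.
have a0 : a = 0.
  apply: contraNeq Q0 => a0; rewrite cE.
  have p1 : X1 p = 0.
    by apply: (mulfI a0); apply: (addIr (t * (w * X2 p))); rewrite -e1 st; ring.
  have p2 : X2 p = 0.
    by apply: (mulfI a0); apply: (addIr (t * X1 p)); rewrite -e2 st; ring.
  by rewrite p1 p2 !expr0n mulr0 subr0.
by rewrite st e3 a0 mul0r add0r.
Qed.

(** The joins of [U3] with the points [(x.1, x.2, 0, 1)] are the [q^2] lines through [U3] outside
    the plane [X4 = 0], all of them secants. *)
Lemma deg_L2prime_U3 P : subsp_val P = <[U3 F]>%VS ->
  (#|F| * #|F| <= deg (L2prime w) P)%N.
Proof.
move=> Pp; rewrite -card_prod -cardsT.
pose f (x : F * F) := vec x.1 x.2 0 1.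
have u0 : U3 F != 0.
  apply/eqP => /(congr1 (@X3 F)); rewrite U3E X_vec X0 => /eqP.
  by rewrite oner_eq0.
have i x : indep (U3 F) (f x).
  apply: indep_sym; apply: indep_X4 => //; first by rewrite X_vec oner_eq0.
  by rewrite U3E X_vec.
apply: (deg_ge (f := f) Pp) => // [x l _ lE|x y a b _ _ e].
  have ul : U3 F \in subsp_val l.
    by rewrite lE mem_joinl.
  have fl : f x \in subsp_val l.
    by rewrite lE mem_joinr.
  rewrite !inE ul andbT; apply/eqP.
  by apply: secant_U3 fl ul _; rewrite // X_vec oner_eq0.
move: e; rewrite U3E => e.
have b1 : b = 1.
  by have := congr1 (@X4 F) e; rewrite X4_lin !X_vec mulr0 add0r mulr1.
have := congr1 (@X1 F) e; have := congr1 (@X2 F) e; rewrite !X_lin !X_vec b1.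
rewrite !mulr0 !add0r !mul1r.
by case: x y {e} => [? ?] [? ?] /= -> ->.
Qed.

Lemma L3_no_E p l : p != 0 -> Ql w 0 p = 0 -> p \in subsp_val l -> l \notin L3 w.
Proof.
move=> p0 Qp pl; apply/negP => /L3_anisotropic/(_ pl p0).
by rewrite Qp eqxx.
Qed.

Hypothesis q_ge7 : (7 <= #|F|)%N.

(** All degrees in [L'] and [L''] satisfy this, while some degree in [L'''] falls between [(q+3)/2]
    and [5(q+1)/2]. Everything is doubled to avoid halves. *)
Definition gap (n : nat) := ((n.*2 <= #|F| + 3) || (5 * #|F|.+1 < n.*2))%N.

(** The inequality [q(q-1) > 5(q+1)] holds from [q = 7] on, where it reads [42 > 40]. *)
Lemma gap_external n : (#|F| * #|F|.-1 <= n.*2)%N -> gap n.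
Proof.
rewrite /gap; case: #|F| q_ge7 => // q /= q6 h; apply/orP; right.
by apply: leq_trans h; nia.
Qed.

Lemma gap_external_out n : (#|F|.+1 * #|F|.-1 <= n.*2)%N -> gap n.
Proof. by move=> h; apply/gap_external/(leq_trans _ h); rewrite leq_mul. Qed.

Lemma point_normalized P : exists p, [/\ p != 0, subsp_val P = <[p]>%VS &
  (X4 p == 0) || (X4 p == 1)].
Proof.
have [p p0 Pp] := pointP P; have [p4|p4] := eqVneq (X4 p) 0.
  by exists p; rewrite p0 p4 eqxx.
exists ((X4 p)^-1 *: p); split; first by rewrite scaler_eq0 invr_eq0 (negbTE p4).
  by rewrite vlineZ ?invr_eq0.
by rewrite XZ mulVf // eqxx orbT.
Qed.

Lemma gap_Lprime P : gap (deg (Lprime w) P).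
Proof.
have [p [p0 Pp /orP p4]] := point_normalized P.
have [Q0|Q0] := eqVneq (Ql w 0 p) 0.
  have : (deg (Lprime w) P <= deg (L0 w) P)%N.
    apply/subset_leq_card/subsetP => l; rewrite inE (in_lines_through _ Pp).
    rewrite inE => /andP[/orP[lL|lL] pl]; rewrite inE (in_lines_through _ Pp) pl andbT //.
    by rewrite (negbTE (L3_no_E p0 Q0 pl)) in lL.
  have := deg_L0_E q_odd w_nonsquare p0 Pp Q0; rewrite /gap; lia.
case: p4 => /eqP p4.
  apply/gap_external/(card_external_in p4 Pp Q0) => l v lL _ _ _.
  by rewrite inE lL orbT.
apply/gap_external_out/(card_external_out p4 Pp Q0) => l lL _.
by rewrite inE lL orbT.
Qed.

(** Only the join of [p] and [U3] qualifies; in [L''] it raises the bound at such points of [E] from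
    [(q+1)/2] to [(q+3)/2]. *)
Lemma L2prime_deg1 p P : X4 p != 0 -> subsp_val P = <[p]>%VS ->
  (deg (L2prime w) P <= 1)%N.
Proof.
move=> p4 Pp; rewrite -(cards1 (<[p]> + <[U3 F]>)%VS) /deg -(card_imset _ val_inj).
apply/subset_leq_card/subsetP => _ /imsetP[l + ->].
rewrite inE (in_lines_through _ Pp) !inE => /andP[/andP[_ ul] pl].
apply/eqP/line_join => //; apply: indep_X4 => //; rewrite U3E ?X_vec //.
by apply/eqP => /(congr1 (@X3 F)); rewrite X_vec X0 => /eqP; rewrite oner_eq0.
Qed.

Lemma in_Lsecond_out l v : l \in L3 w -> v \in subsp_val l -> X4 v != 0 ->
  l \in Lsecond w.
Proof.
move=> lL vl v4; have v0 := X4_neq0 v4; have [R Rv] := point_of v0.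
rewrite inE in_setD; apply/orP; left; apply/andP; split; last by rewrite inE lL orbT.
rewrite inE lL /=; apply/subsetPn; exists R; first by rewrite (in_pts_vline _ Rv).
by rewrite (in_planeX4 v0 Rv).
Qed.

Lemma gap_Lsecond P : gap (deg (Lsecond w) P).
Proof.
have [p [p0 Pp p4]] := point_normalized P.
have [Q0|Q0] := eqVneq (Ql w 0 p) 0; last first.
  case/orP: p4 => /eqP p4.
    apply/gap_external/(card_external_in p4 Pp Q0) => l v lL _ vl v4.
    by apply: in_Lsecond_out lL vl _; rewrite v4 oner_eq0.
  apply/gap_external_out/(card_external_out p4 Pp Q0) => l lL pl.
  by apply: in_Lsecond_out lL pl _; rewrite p4 oner_eq0.
(* On [E] a vanishing last coordinate means [U3], whose [q^2] secants give it a large degree. *)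
have [p40|p40] := eqVneq (X4 p) 0.
  move: Q0; rewrite Ql_X4 // /nrm /= => /(nrm0 w_nonsquare)[p1 p2].
  have p3 : X3 p != 0 by apply: contraNneq p0 => p3; apply/eqP/vecP; rewrite X0.
  have : (#|F| * #|F| <= deg (L2prime w) P)%N.
    apply: deg_L2prime_U3; rewrite Pp -[RHS](vlineZ _ p3); congr <[_]>%VS.
    by rewrite U3E; apply: vecP; rewrite XZ X_vec ?mulr0 ?mulr1.
  have : (deg (L2prime w) P <= deg (Lsecond w) P)%N.
    by apply: degS => l lL; rewrite inE lL orbT.
  move=> h1 h2; have h := leq_trans h2 h1; apply: gap_external.
  by move: h q_ge7; case: #|F| => //= q; nia.
have : (deg (Lsecond w) P <= deg (L0 w) P + deg (L2prime w) P)%N.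
  apply: leq_trans (degU _ _ _); apply/subset_leq_card/subsetP => l.
  rewrite !in_setI (in_lines_through _ Pp) => /andP[lL pl]; rewrite pl andbT.
  case/setUP: lL => [/setDP[/setUP[lL|lL] _]|lL]; rewrite in_setU ?lL ?orbT //.
  by rewrite (negbTE (L3_no_E p0 Q0 pl)) in lL.
have := deg_L0_E q_odd w_nonsquare p0 Pp Q0; have := L2prime_deg1 p40 Pp.
rewrite /gap; lia.
Qed.

End Degrees.

(** * Lines missing from [L'''] *)

Section Third.

Variables (F : finFieldType) (w l1 l2 : F).
Hypotheses (q_odd : odd #|F|) (q_ge7 : (7 <= #|F|)%N).
Hypothesis w_nonsquare : nonsquare w.
Hypotheses (l1_square : nonzero_square l1) (l2_nonsquare : nonsquare l2).
Implicit Types (p u v : 'rV[F]_4) (P R : point F) (l : line F).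

Let l1_neq0 : l1 != 0. Proof. by case/andP: l1_square. Qed.
Let l2_neq0 : l2 != 0. Proof. exact: nonsquare_neq0. Qed.

Lemma pts_planeX4 l p v R : p \in subsp_val l -> X4 p != 0 ->
  v \in subsp_val l -> v != 0 -> X4 v = 0 -> subsp_val R = <[v]>%VS ->
  pts l :&: planeX4 F = [set R].
Proof.
move=> pl p4 vl v0 v4 Rv; apply/setP => S; rewrite in_set1 in_setI.
apply/idP/eqP => [|->]; last first.
  by rewrite (in_pts_vline _ Rv) vl (in_planeX4 v0 Rv) v4 eqxx.
have [x x0 Sx] := pointP S; rewrite (in_pts_vline _ Sx) (in_planeX4 x0 Sx).
rewrite (line_join pl vl (indep_X4 p4 v0 v4)) => /andP[/mem_joinP[a [b xE]]].
rewrite xE X4_lin v4 mulr0 addr0 mulf_eq0 (negbTE p4) orbF => /eqP a0.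
move: xE; rewrite a0 scale0r add0r => xE.
have b0 : b != 0 by apply: contraNneq x0 => b0; rewrite xE b0 scale0r.
by apply: val_inj; rewrite [LHS]Sx [RHS]Rv xE vlineZ.
Qed.

Lemma card_pi0 l p v : p \in subsp_val l -> X4 p != 0 ->
  v \in subsp_val l -> v != 0 -> X4 v = 0 -> nonzero_square (Ql w 0 v) ->
  #|pts l :&: pi0 w| = 1%N.
Proof.
move=> pl p4 vl v0 v4 Qv; have [R Rv] := point_of v0.
rewrite /pi0 setIA (pts_planeX4 pl p4 vl v0 v4 Rv).
rewrite -[RHS](cards1 R); congr #|pred_of_set _|; apply/setIidPl.
by rewrite sub1set (in_Os w v0 Rv).
Qed.

(** A line outside [L0] and [L3] can enter only through [setB], whose lines are secants of [E]
    tangent to [Elam l1] or [Elam l2]. *)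
Lemma notin_Lthird l : l \notin L0 w -> l \notin L3 w ->
  l \notin L2 w \/
    ((#|pts l :&: Elam w l1| != 1)%N /\ (#|pts l :&: Elam w l2| != 1)%N) ->
  l \notin Lthird w l1 l2.
Proof.
move=> n0 n3 h; apply/negP => /setUP[/setDP[/setUP[lL|lL] _]|].
- by rewrite lL in n0.
- by rewrite lL in n3.
by case/setUP; rewrite inE => /andP[lL /andP[c _]]; case: h => [|[]]; rewrite ?lL ?c.
Qed.

(** Such a line is a secant of every quadric [Elam], hence tangent to none. *)
Lemma secant_U3_notin l v : v \in subsp_val l -> U3 F \in subsp_val l ->
  X4 v != 0 -> l \notin Lthird w l1 l2.
Proof.
move=> vl ul v4; have c lam := secant_U3 w q_odd lam vl ul v4.
apply: notin_Lthird; last by right; rewrite !c.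
  by rewrite inE (c 0).
by rewrite inE -cards_eq0 (c 0).
Qed.

(** The line is tangent to [E] at [p] because the discriminant vanishes, and [v] keeps it out of
    [L0]. *)
Lemma nonsquare_tangent_notin l p v : p \in subsp_val l -> v \in subsp_val l ->
  indep p v -> Ql w 0 p = 0 -> Bl w 0 v p = 0 -> nonsquare (Ql w 0 v) ->
  l \notin Lthird w l1 l2.
Proof.
move=> pl vl i Qp B0 ns; have i' := indep_sym i.
have [p0 _] := andP i; apply: notin_Lthird; first 1 last.
- exact: L3_no_E pl.
- left; have lE := line_join vl pl i'.
  by rewrite (in_L2 q_odd lE) ?nonsquare_neq0 // B0 Qp mulr0 expr0n subrr /nonzero_square
    eqxx.
- apply: contraL ns => lL; have [_ /andP[_]] := L0_through q_odd lL pl Qp vl i.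
  by rewrite negbK.
Qed.

(** Since [p] is on [E] with [X4 p = 1], it has [Q_lam(p) = lam], so the discriminant for [Elam lam]
    is [1 - 4 lam Q(v)], non-zero for both parameters. *)
Lemma secant_notin l p v : p \in subsp_val l -> v \in subsp_val l ->
  X4 p = 1 -> Ql w 0 p = 0 -> v != 0 -> X4 v = 0 -> Ql w 0 v != 0 ->
  Bl w 0 v p = 1 -> 4 * l1 * Ql w 0 v != 1 -> 4 * l2 * Ql w 0 v != 1 ->
  l \notin Lthird w l1 l2.
Proof.
move=> pl vl p4 Qp v0 v4 Qv Bv h1 h2.
have i : indep p v by apply: indep_X4; rewrite ?p4 ?oner_eq0.
have i' := indep_sym i; have lE := line_join vl pl i'.
have tg lam : 4 * lam * Ql w 0 v != 1 -> (#|pts l :&: Elam w lam| != 1)%N.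
  have Qv' : Ql w lam v = Ql w 0 v by rewrite !Ql_X4.
  rewrite (tangent_Elam q_odd lE) // ?Qv' //.
  have -> : Bl w lam v p = 1 by rewrite -Bv /Bl v4; ring.
  have -> : Ql w lam p = lam.
    by rewrite -[RHS]addr0 -Qp /Ql p4; ring.
  by rewrite expr1n eq_sym mulrAC.
have p0 : p != 0 by case/andP: i.
apply: notin_Lthird; last by right; split; apply: tg.
  apply/negP => lL; have [B0 _] := L0_through q_odd lL pl Qp vl i.
  have : Bl w 0 v p = 0 by rewrite -[RHS]B0 /Bl; ring.
  by rewrite Bv => /eqP; rewrite oner_eq0.
exact: L3_no_E pl.
Qed.

Lemma nrm_nonsquare : exists x, nonsquare (nrm w x).
Proof. by have [x xE] := nrm_surj q_odd w_nonsquare w; exists x; rewrite xE. Qed.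

Let U3_neq0 : U3 F != 0.
Proof.
by apply/eqP => /(congr1 (@X3 F)); rewrite U3E X_vec X0 => /eqP; rewrite oner_eq0.
Qed.

Let X4_U3 : X4 (U3 F) = 0. Proof. by rewrite U3E X_vec. Qed.

Lemma Bl_U3 v : Bl w 0 v (U3 F) = X4 v.
Proof. by rewrite U3E /Bl !X_vec; ring. Qed.

Lemma Ql_U3 lam : Ql w lam (U3 F) = 0.
Proof. by rewrite U3E /Ql !X_vec; ring. Qed.

Lemma nonsquare_indep_U3 v : X4 v = 0 -> nonsquare (Ql w 0 v) -> indep (U3 F) v.
Proof.
move=> v4 ns; rewrite /indep U3_neq0; apply: contraL ns => /vlineP[k ->].
by rewrite QlZ Ql_U3 mulr0 negbK square0.
Qed.

Lemma star_missing P : exists2 l, P \in pts l & l \notin Lthird w l1 l2.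
Proof.
have [p [p0 Pp p4]] := point_normalized P.
(* Off the plane [X4 = 0] the join with [U3] serves. *)
have [p40|p40] := eqVneq (X4 p) 0; last first.
  have i : indep p (U3 F) by apply: indep_X4.
  have [l lE] := line_through i; exists l.
    by rewrite (in_pts_vline _ Pp) lE mem_joinl.
  by apply: (@secant_U3_notin _ p); rewrite // lE ?mem_joinl ?mem_joinr.
(* If [Q(p) = 0], then [p] spans the point [U3], and its join with [(0,0,0,1)] serves. *)
have [Q0|Q0] := eqVneq (Ql w 0 p) 0.
  have i : indep (vec 0 0 0 1) p by apply: indep_X4; rewrite ?X_vec ?oner_eq0.
  have [l lE] := line_through i; exists l.
    by rewrite (in_pts_vline _ Pp) lE mem_joinr.
  apply/negP => lL; have := lL; apply/negP.
  apply: (@secant_U3_notin _ (vec 0 0 0 1)); rewrite ?X_vec ?oner_eq0 //.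
    by rewrite lE mem_joinl.
  move: Q0; rewrite Ql_X4 // /nrm /= => /(nrm0 w_nonsquare)[p1 p2].
  have p3 : X3 p != 0 by apply: contraNneq p0 => p3; apply/eqP/vecP; rewrite X0.
  rewrite (_ : U3 F = (X3 p)^-1 *: p) ?memvZ // ?lE ?mem_joinr //.
  by apply: vecP; rewrite U3E XZ X_vec ?p1 ?p2 ?p40 ?mulr0 ?mulVf.
(* For non-square [Q(p)] the line joining [U3] and [p] is a tangent at [U3] outside [L0]; for square
   [Q(p)] a line of [T20] through [p] is built. *)
have [sq|ns] := boolP (square (Ql w 0 p)); last first.
  have i := nonsquare_indep_U3 p40 ns; have [l lE] := line_through i.
  exists l; first by rewrite (in_pts_vline _ Pp) lE mem_joinr.
  apply: (@nonsquare_tangent_notin _ (U3 F) p); rewrite ?lE ?mem_joinl ?mem_joinr //.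
    exact: Ql_U3.
  by rewrite Bl_U3.
set c := Ql w 0 p in Q0 sq.
have cE : c = X1 p ^+ 2 - w * X2 p ^+ 2 by rewrite /c /Ql p40; ring.
(* [v] is the point where a line through [p] touches [E_l2]. *)
pose s := - X3 p / (2 * c).
pose v := vec (s * X1 p) (s * X2 p) (- (s ^+ 2 * c + l2)) 1.
have t0 := two_neq0 q_odd.
have v4 : X4 v != 0 by rewrite X_vec oner_eq0.
have i : indep p v by apply/indep_sym/indep_X4.
have [l lE] := line_through i.
(* The value of [s] makes [p] and [v] orthogonal, so their join touches [Elam l2] at [v]. *)
have B0 lam : Bl w lam p v = 0.
  transitivity (2 * c * s + X3 p).
    by rewrite /Bl !X_vec p40 cE; ring.
  by rewrite /s mulrC divfK ?mulf_neq0 // addNr.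
have Q2 : Ql w l2 v = 0 by rewrite /Ql !X_vec cE; ring.
have Qv : Ql w 0 v = - l2 by rewrite /Ql !X_vec cE; ring.
have Qp lam : Ql w lam p = c by rewrite /c !Ql_X4.
(* The discriminant is [4 c l2], with [c] a non-zero square and [l2] a non-square. *)
have l3 : l \in L3 w.
  rewrite (in_L3 q_odd lE) // B0 Qv Qp expr0n sub0r mulrN opprK.
  have /existsP[r /eqP cr] := sq.
  have r0 : r != 0 by apply: contraNneq Q0 => r0; rewrite cr r0 expr0n.
  rewrite cr (_ : 4 * r ^+ 2 * l2 = (2 * r) ^+ 2 * l2); last by ring.
  by rewrite /nonsquare squareMl ?mulf_neq0.
have l20 : l \in T20 w l2.
  rewrite inE l3 (tangent_Elam q_odd lE) ?Qp // B0 Q2 expr0n mulr0 eqxx /=.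
  rewrite (@card_pi0 _ v p) ?lE ?mem_joinl ?mem_joinr //.
  by apply/andP.
(* Lines of [T20] are removed from [L']; being external, this one is not restored by [setB]. *)
exists l; first by rewrite (in_pts_vline _ Pp) lE mem_joinl.
have l2n : l \notin L2 w.
  by move: l3; rewrite !inE -cards_eq0 => /eqP ->.
rewrite in_setU in_setD negb_or in_setU l20 orbT /= in_setU negb_or.
by rewrite ![l \in tangent_meeting _ _ _ _]inE (negbTE l2n).
Qed.

(** [W] is at least a hyperplane, so [W] and [u] together span the whole space. *)
Lemma line_mod (W : {vspace 'rV[F]_4}) u : (3 <= \dim W)%N -> u \notin W ->
  forall e, exists k, e + k *: u \in W.
Proof.
move=> dW uW e; have u0 : u != 0 by apply: contraNneq uW => ->; rewrite mem0v.
have : (W + <[u]> == fullv)%VS.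
  rewrite eqEdim subvf dimvf dim_matrix dimv_disjoint_sum.
    by rewrite dim_vline u0 addn1.
  apply/eqP; rewrite -subv0; apply/subvP => x; rewrite memv_cap memv0.
  case/andP => xW /vlineP[k xE]; apply: contraNT uW => x0.
  have k0 : k != 0 by apply: contraNneq x0 => k0; rewrite xE k0 scale0r.
  by rewrite -(scalerK k0 u) -xE memvZ.
move/eqP => full; have : e \in (W + <[u]>)%VS by rewrite full memvf.
case/memv_addP => x xW [y /vlineP[k ->] ->]; exists (- k).
by rewrite scaleNr addrK.
Qed.

Lemma card_quadratic_roots (a b c : F) : a != 0 ->
  (#|[set s : F | (a * s ^+ 2 + b * s + c == 0)%R]| <= 2)%N.
Proof.
move=> a0; have t0 := two_neq0 q_odd.
pose f s := 2 * a * s + b.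
have f_inj : injective f by move=> x y /addIr/mulfI; apply; rewrite mulf_neq0.
apply: (@leq_trans #|[set u : F | (u ^+ 2 == b ^+ 2 - 4 * a * c)%R]|).
  rewrite -(card_imset _ f_inj); apply/subset_leq_card/subsetP => _ /imsetP[s + ->].
  rewrite !inE => /eqP e; rewrite -subr_eq0; apply/eqP.
  transitivity (4 * a * (a * s ^+ 2 + b * s + c)); first by rewrite /f; ring.
  by rewrite e mulr0.
by rewrite card_sqrt //; case: ifP => // _; case: ifP.
Qed.

(** Along the affine line [a x + b y = 1] the norm is a quadratic polynomial with non-zero leading
    coefficient, so each value is taken at most twice; four bad parameters cannot exhaust [F]. *)
Lemma avoid_nrm (a b d1 d2 : F) : (a, b) != (0, 0) ->
  exists x : F * F, [/\ a * x.1 + b * x.2 = 1, nrm w x != d1 & nrm w x != d2].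
Proof.
move=> ab; have w0 := nonsquare_neq0 w_nonsquare.
have n0 : nrm w (b, a) != 0 by rewrite nrm_eq0 // xpair_eqE andbC -xpair_eqE.
(* The base point is norm-orthogonal to the direction [(-b, a)], so the norm has no linear term in
   [s]. *)
pose x (s : F) := (- (w * a) / nrm w (b, a) - s * b, b / nrm w (b, a) + s * a).
have n1 : nrm w (- b, a) != 0 by rewrite /nrm /= sqrrN.
pose bad d := [set s | nrm w (x s) == d].
have badE d : (#|bad d| <= 2)%N.
  rewrite /bad.
  have := card_quadratic_roots 0 (nrm w (- (w * a), b) / nrm w (b, a) ^+ 2 - d) n1.
  apply: leq_trans; apply/subset_leq_card/subsetP => s; rewrite !inE.
  rewrite -subr_eq0 => /eqP e; apply/eqP; rewrite -[RHS]e /x /nrm /=.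
  by rewrite /nrm /= in n0; field.
have /subsetPn[s _] : ~~ ([set: F] \subset bad d1 :|: bad d2).
  apply/negP => /subset_leq_card; rewrite cardsT => /(leq_trans q_ge7).
  have : (#|bad d1 :|: bad d2| <= #|bad d1| + #|bad d2|)%N.
    by rewrite leq_card_setU.
  by have := badE d1; have := badE d2; lia.
rewrite !inE negb_or => /andP[h1 h2]; exists (x s); split=> //.
by rewrite /x /=; move: n0; rewrite /nrm /= => n0; field.
Qed.

(** If [W] contains [U3], a line through [U3] works. Otherwise [W] is a graph
    [X3 = a X1 + b X2 + c X4], and the line is taken through a point of [E] in [W]. *)
Lemma plane_missing (W : {vspace 'rV[F]_4}) : (3 <= \dim W)%N ->
  exists2 l : line F, (l <= W)%VS & l \notin Lthird w l1 l2.
Proof.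
move=> dW; have subW p v (l : line F) : subsp_val l = (<[p]> + <[v]>)%VS ->
    p \in W -> v \in W -> (l <= W)%VS.
  by move=> -> pW vW; rewrite subv_add -!memvE pW.
have [uW|uW] := boolP (U3 F \in W).
  have [/existsP[v /andP[vW v4]]|/existsPn W4] :=
      boolP [exists v, (v \in W) && (X4 v != 0)].
    have [l lE] := line_through (indep_X4 v4 U3_neq0 X4_U3).
    exists l; first exact: subW lE vW uW.
    by apply: (secant_U3_notin _ _ v4); rewrite lE ?mem_joinl ?mem_joinr.
  (* In this case [W] lies in the plane [X4 = 0], and by dimension it is that plane. *)
  have inW v : X4 v = 0 -> v \in W.
    move=> v4; have eW : vec 0 0 0 1 \notin W.
      by have := W4 (vec 0 0 0 1); rewrite X_vec oner_eq0 andbT.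
    have [k kW] := line_mod dW eW v; have := W4 (v + k *: vec 0 0 0 1).
    rewrite kW negbK -[v]scale1r X4_lin X_vec v4 mulr0 add0r mulr1 => /eqP k0.
    by move: kW; rewrite k0 scale0r addr0 scale1r.
  have [x xns] := nrm_nonsquare.
  pose v := vec x.1 x.2 0 0.
  have v4 : X4 v = 0 by rewrite X_vec.
  have Qv : Ql w 0 v = nrm w x by rewrite /Ql /nrm !X_vec; ring.
  rewrite -Qv in xns.
  have i := nonsquare_indep_U3 v4 xns; have [l lE] := line_through i.
  exists l; first by apply: subW lE uW _; apply: inW.
  apply: (nonsquare_tangent_notin _ _ i); rewrite ?Ql_U3 ?Bl_U3 //;
  by rewrite lE ?mem_joinl ?mem_joinr.
have graph e : exists c, vec (X1 e) (X2 e) c (X4 e) \in W.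
  have [k kW] := line_mod dW uW e; exists (X3 e + k); rewrite -[X in X \in W](_ : e + k *: U3 F = _) //.
  rewrite -[e]scale1r U3E; apply: vecP; rewrite X_lin !X_vec XZ; ring.
have [a] := graph (vec 1 0 0 0); have [b] := graph (vec 0 1 0 0).
have [c] := graph (vec 0 0 0 1); rewrite !X_vec => eW4 eW2 eW1.
have inW x y z : vec x y (a * x + b * y + c * z) z \in W.
  rewrite (_ : vec _ _ _ _ = 1 *: (x *: vec 1 0 a 0 + y *: vec 0 1 b 0)
    + z *: vec 0 0 c 1); first by rewrite memvD ?memvZ // memvD ?memvZ.
  by apply: vecP; rewrite !X_lin !X_vec; ring.
have t0 := two_neq0 q_odd; have f0 := four_neq0 q_odd.
have w0 := nonsquare_neq0 w_nonsquare.
have [p [pW p4 Qp]] : exists p, [/\ p \in W, X4 p = 1 & Ql w 0 p = 0].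
  (* Completing squares turns the equation of [E] at the points of the graph with [X4 = 1] into this
     norm equation. *)
  have [[y z] yz] := nrm_surj q_odd w_nonsquare (a ^+ 2 / 4 - b ^+ 2 / (4 * w) - c).
  exists (vec (y - a / 2) (z + b / (2 * w))
    (a * (y - a / 2) + b * (z + b / (2 * w)) + c * 1) 1); split; rewrite ?X_vec //.
  transitivity (nrm w (y, z) - (a ^+ 2 / 4 - b ^+ 2 / (4 * w) - c)).
    by rewrite /Ql /nrm !X_vec /=; field; rewrite ?t0 ?w0 ?f0.
  by rewrite yz subrr.
have p40 : X4 p != 0 by rewrite p4 oner_eq0.
(* These are the coefficients of the polar form with [p] on the part of [W] in [X4 = 0]; both vanish
   exactly when [W] is the tangent plane of [E] at [p]. *)
pose a' := 2 * X1 p + a; pose b' := b - 2 * w * X2 p.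
pose v x y := vec x y (a * x + b * y + c * 0) 0.
have v4 x y : X4 (v x y) = 0 by rewrite X_vec.
have Qv x y : Ql w 0 (v x y) = nrm w (x, y) by rewrite /Ql /nrm !X_vec /=; ring.
have Bv x y : Bl w 0 (v x y) p = a' * x + b' * y.
  by rewrite /Bl !X_vec p4 /a' /b'; ring.
have [[a0 b0]|ab] := eqVneq (a', b') (0, 0).
  have [[x y] xns] := nrm_nonsquare; rewrite -Qv in xns.
  have v0 : v x y != 0.
    apply: contraTneq (nonsquare_neq0 xns) => ->.
    by rewrite /Ql !X0 !expr0n !mulr0 !addr0 subr0 eqxx.
  have i := indep_X4 p40 v0 (v4 x y); have [l lE] := line_through i.
  exists l; first exact: subW lE pW (inW _ _ _).
  apply: (nonsquare_tangent_notin _ _ i); rewrite ?Bv ?a0 ?b0 ?mul0r ?addr0 //;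
  by rewrite lE ?mem_joinl ?mem_joinr.
(* The excluded norms are those for which the line would touch [Elam l1] or [Elam l2]. *)
have [[x y] [/= xy h1 h2]] := avoid_nrm (4 * l1)^-1 (4 * l2)^-1 ab.
have xy0 : (x, y) != (0, 0).
  apply/eqP => -[x0 y0]; move: xy; rewrite x0 y0 !mulr0 addr0 => /eqP.
  by rewrite eq_sym oner_eq0.
have v0 : v x y != 0.
  apply: contraNneq xy0 => e.
  have := congr1 (@X1 F) e; have := congr1 (@X2 F) e.
  by rewrite !X_vec !X0 => -> ->.
have i := indep_X4 p40 v0 (v4 x y); have [l lE] := line_through i.
exists l; first exact: subW lE pW (inW _ _ _).
have inv d : d != 0 -> nrm w (x, y) != (4 * d)^-1 -> 4 * d * nrm w (x, y) != 1.
  move=> d0; apply: contraNneq => e; apply/eqP/(mulfI (mulf_neq0 f0 d0)).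
  by rewrite e divff ?mulf_neq0.
apply: (@secant_notin _ p (v x y)); rewrite ?Qv ?Bv ?nrm_eq0 ?inv //;
by rewrite lE ?mem_joinl ?mem_joinr.
Qed.

(** * The degree of the point [(0,0,0,1)] in [L'''] *)

Let U4 := vec 0 0 0 1 : 'rV[F]_4.

(** For non-zero [d], the pairs for which the join of [U4] and [(x.1, x.2, 1, 0)] touches
    [Elam d]. *)
Let C (d : F) := [set x | nrm w x == (4 * d)^-1].

Let cardC d : d != 0 -> #|C d| = #|F|.+1.
Proof. by move=> d0; rewrite card_nrm ?invr_eq0 ?mulf_neq0 ?four_neq0. Qed.

(** The [q+1] lines of [T10] through this point already give the bound, which exceeds [(q+3)/2]. *)
Lemma deg_Lthird_ge P : subsp_val P = <[U4]>%VS ->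
  (#|F|.+1 <= deg (Lthird w l1 l2) P)%N.
Proof.
move=> PU; rewrite -(cardC l1_neq0).
pose f (x : F * F) := vec x.1 x.2 1 0.
have f0 x : f x != 0.
  by apply/eqP => /(congr1 (@X3 F)); rewrite X_vec X0 => /eqP; rewrite oner_eq0.
have f4 x : X4 (f x) = 0 by rewrite X_vec.
have u4 : X4 U4 != 0 by rewrite X_vec oner_eq0.
have i x : indep U4 (f x) by apply: indep_X4.
apply: (deg_ge (f := f) PU) => // [x l|x y a b _ _ e].
  rewrite inE => /eqP nx lE; rewrite in_setU; apply/orP; right.
  rewrite in_setU; apply/orP; left.
  have i' := indep_sym (i x); have lE' : subsp_val l = (<[f x]> + <[U4]>)%VS.
    by rewrite lE addvC.
  have Qf lam : Ql w lam (f x) = (4 * l1)^-1.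
    by rewrite Ql_X4 // !X_vec -nx -surjective_pairing.
  have n0 : (4 * l1)^-1 != 0 by rewrite invr_eq0 mulf_neq0 ?four_neq0.
  have Bf lam : Bl w lam (f x) U4 = 1 by rewrite /Bl !X_vec; ring.
  have QU lam : Ql w lam U4 = lam by rewrite /Ql !X_vec; ring.
  have sq1 : nonzero_square (1 : F).
    by rewrite /nonzero_square oner_eq0; apply/existsP; exists 1; rewrite expr1n.
  rewrite inE (in_L2 q_odd lE') ?Qf // Bf QU mulr0 subr0 expr1n sq1 /=.
  rewrite (tangent_Elam q_odd lE') ?Qf // Bf QU.
  rewrite expr1n mulrAC mulfV ?mulf_neq0 ?four_neq0 // eqxx /=.
  rewrite (@card_pi0 _ U4 (f x)) ?lE ?mem_joinl ?mem_joinr //.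
  (* The point in [X4 = 0] belongs to [pi0] because [1/(4 l1)] is a square along with [l1]. *)
  rewrite Qf /nonzero_square n0 /=.
  case/andP: l1_square => _ /existsP[r /eqP rE]; apply/existsP.
  by exists (2 * r)^-1; rewrite exprVn rE; apply/eqP; congr _^-1; ring.
have b1 : b = 1.
  by have := congr1 (@X3 F) e; rewrite X3_lin !X_vec mulr0 add0r mulr1.
have := congr1 (@X1 F) e; have := congr1 (@X2 F) e; rewrite !X_lin !X_vec b1.
rewrite !mulr0 !add0r !mul1r.
by case: x y {e} => [? ?] [? ?] /= -> ->.
Qed.

(** The point is on [E], so no line of [L3] passes through it; [L0] contributes at most [(q+1)/2]
    lines and the tangents to each of the two quadrics at most [q+1]. *)
Lemma deg_Lthird_le P : subsp_val P = <[U4]>%VS ->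
  ((deg (Lthird w l1 l2) P).*2 <= 5 * #|F|.+1)%N.
Proof.
move=> PU.
have u4 : X4 U4 != 0 by rewrite X_vec oner_eq0.
have QU lam : Ql w lam U4 = lam by rewrite /Ql !X_vec; ring.
have U0 : U4 != 0 by apply: contraNneq u4 => ->; rewrite X0.
have h1 := deg_L0_E q_odd w_nonsquare U0 PU (QU 0).
have h2 : (deg (Lthird w l1 l2) P <= deg (L0 w) P + deg (setB w l1 l2) P)%N.
  apply: leq_trans (degU _ _ _); apply/subset_leq_card/subsetP => l.
  rewrite !in_setI (in_lines_through _ PU) => /andP[lL pl]; rewrite pl andbT.
  case/setUP: lL => [/setDP[/setUP[lL|lL] _]|lL]; rewrite in_setU ?lL ?orbT //.
  by rewrite (negbTE (L3_no_E U0 (QU 0) pl)) in lL.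
have h3 : (deg (setB w l1 l2) P <= #|C l1| + #|C l2|)%N.
  pose f (x : F * F) := vec x.1 x.2 1 0.
  apply: leq_trans (leq_card_setU _ _).
  apply: leq_trans (leq_imset_card (fun x => <[U4]> + <[f x]>)%VS _).
  apply: (deg_le PU) => l lB pl.
  have [lam [lam0 subC tg]] : exists lam, [/\ lam != 0, {subset C lam <= C l1 :|: C l2}
      & (#|pts l :&: Elam w lam| == 1)%N].
    case/setUP: lB; rewrite inE => /andP[_ /andP[tg _]];
      [exists l1|exists l2]; split=> // x xC; by rewrite in_setU xC ?orbT.
  have [v [vl v0 v4]] := line_meets_X4 pl u4.
  have i := indep_X4 u4 v0 v4.
  (* If [v] spans [U3], the line is a secant of [Elam lam], contrary to tangency. *)
  have [xy0|xy0] := eqVneq (X1 v, X2 v) (0, 0).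
    case: xy0 => x0 y0.
    by rewrite (secant_U3_point w q_odd lam vl v0 v4 x0 y0 pl u4) in tg.
  have Qv : Ql w lam v != 0 by rewrite Ql_X4 // nrm_eq0.
  have lE := line_join vl pl (indep_sym i).
  move: tg; rewrite (tangent_Elam q_odd lE) ?(indep_sym i) // QU.
  have -> : Bl w lam v U4 = X3 v by rewrite /Bl !X_vec v4; ring.
  rewrite Ql_X4 // => /eqP e; rewrite Ql_X4 // in Qv.
  have x3 : X3 v != 0.
    apply: contraNneq (mulf_neq0 (mulf_neq0 (four_neq0 q_odd) Qv) lam0) => x3.
    by rewrite -e x3 expr0n.
  (* Scaling the third coordinate to 1 turns the tangency condition [X3(v)^2 = 4 lam nrm] into norm
     [1/(4 lam)]. *)
  exists ((X3 v)^-1 * X1 v, (X3 v)^-1 * X2 v).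
  have fE : f ((X3 v)^-1 * X1 v, (X3 v)^-1 * X2 v) = (X3 v)^-1 *: v.
    by apply: vecP; rewrite XZ !X_vec ?v4 ?mulr0 ?mulVf.
  split.
  - apply: subC; rewrite inE; apply/eqP.
    transitivity (nrm w (X1 v, X2 v) / X3 v ^+ 2); first by rewrite /nrm /=; field.
    by rewrite e; have f4 := four_neq0 q_odd; field; rewrite Qv lam0 f4.
  - by rewrite fE memvZ.
  - by rewrite fE; apply: indep_X4 => //; rewrite ?XZ ?v4 ?mulr0 // scaler_eq0
      invr_eq0 negb_or x3.
rewrite !cardC // in h3; lia.
Qed.

Lemma Lthird_gap : exists P, ~~ gap F (deg (Lthird w l1 l2) P).
Proof.
have U0 : U4 != 0 by apply: X4_neq0; rewrite X_vec oner_eq0.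
have [P PU] := point_of U0; exists P.
have := deg_Lthird_ge PU; have := deg_Lthird_le PU; rewrite /gap; lia.
Qed.

End Third.

(** * Transport of degrees, stars and planes by collineations *)

Section Collineations.

Variable F : finFieldType.
Implicit Types (L M : {set line F}) (P R : point F) (l : line F).

(** A line is determined by its points, so the induced map on lines is well defined and injective;
    the default in [odflt] is never taken. *)
Lemma collineation_line_map (phi : {perm point F}) : collineation phi ->
  exists2 f : line F -> line F, injective f & forall l, pts (f l) = phi @: pts l.
Proof.
move=> col; pose f l := odflt l [pick m | phi @: pts l == pts m].
have fE l : pts (f l) = phi @: pts l.
  rewrite /f; case: pickP => [m /eqP -> //|no].
  by have [m mE] := col l; have := no m; rewrite mE eqxx.
exists f => // l m e; apply: pts_inj.
by apply: (imset_inj (@perm_inj _ phi)); rewrite -!fE e.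
Qed.

Lemma line_image_imset (phi : {perm point F}) (f : line F -> line F) L :
  (forall l, pts (f l) = phi @: pts l) -> line_image phi L = f @: L.
Proof.
move=> fE; apply/setP => m; rewrite inE; apply/exists_inP/imsetP.
  by case=> l lL; rewrite -fE => /eqP/pts_inj ->; exists l.
by case=> l lL ->; exists l; rewrite // fE.
Qed.

Lemma deg_equivalent L M P : equivalent L M -> exists R, deg M R = deg L P.
Proof.
case=> phi col <-; have [f f_inj fE] := collineation_line_map col.
exists (phi P); rewrite (line_image_imset _ fE) /deg.
rewrite -[RHS](card_imset _ f_inj); apply: eq_card => m; apply/setIP/imsetP.
  case=> /imsetP[l lL ->]; rewrite !inE => Pl; exists l => //.
  rewrite !inE lL /=; have : phi P \in pts (f l) by rewrite inE.
  by rewrite fE mem_imset ?inE //; apply: perm_inj.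
case=> l /setIP[lL lP] ->; split; first exact: imset_f.
have : phi P \in pts (f l) by rewrite fE imset_f // inE; rewrite inE in lP.
by rewrite !inE.
Qed.

(** The lines through the preimage of [P] are mapped to lines through [P]. *)
Lemma equivalent_star L M P : equivalent L M -> lines_through P \subset M ->
  exists R, forall l, R \in pts l -> l \in L.
Proof.
case=> phi col <- sub; have [f f_inj fE] := collineation_line_map col.
exists ((phi^-1)%g P) => l Rl; rewrite -(mem_imset _ _ f_inj).
rewrite -(line_image_imset _ fE); apply: (subsetP sub); rewrite inE.
have : P \in pts (f l) by rewrite fE -(permKV phi P) imset_f.
by rewrite inE.
Qed.

Lemma line_sub_plane l (U : {vspace 'rV[F]_4}) P R : P \in pts l -> R \in pts l ->
  P != R -> (P <= U)%VS -> (R <= U)%VS -> (l <= U)%VS.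
Proof.
have [p p0 Pp] := pointP P; have [r r0 Rr] := pointP R.
rewrite (in_pts_vline _ Pp) (in_pts_vline _ Rr) Pp Rr => pl rl PR pU rU.
have i : indep p r.
  rewrite /indep p0; apply: contraNN PR => /vlineP[k rk].
  have k0 : k != 0 by apply: contraNneq r0 => k0; rewrite rk k0 scale0r.
  by apply/eqP/val_inj; rewrite [LHS]Pp [RHS]Rr rk vlineZ.
by rewrite (line_join pl rl i) subv_add pU.
Qed.

(* The preimage of a plane under a collineation is closed under linear
   combinations, and it meets every line because the plane does. *)
Lemma equivalent_plane L M (A : plane F) : equivalent L M ->
  lines_of_plane A \subset M ->
  exists2 W : {vspace 'rV[F]_4}, (3 <= \dim W)%N &
    forall l, (l <= W)%VS -> l \in L.
Proof.
case=> phi col <- sub; have [f f_inj fE] := collineation_line_map col.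
pose inA (v : 'rV[F]_4) :=
  [forall P : point F, (subsp_val P == <[v]>%VS) ==> (phi P <= A)%VS].
have inAP P v : inA v -> subsp_val P = <[v]>%VS -> (phi P <= A)%VS.
  by move=> /forallP/(_ P)/implyP h /eqP.
(* Vacuous, since no point is spanned by 0. *)
have inA0 : inA 0.
  apply/forallP => P; apply/implyP => /eqP e; have := subsp_dim P.
  by rewrite e dim_vline eqxx.
have inAZ k v : inA v -> inA (k *: v).
  have [->|k0] := eqVneq k 0; first by rewrite scale0r.
  by rewrite /inA vlineZ.
(* The join of two points of the preimage is mapped to a line with two points in [A], hence
   contained in [A]. *)
have inAD u v : inA u -> inA v -> inA (u + v).
  move=> uA vA; have [->|u0] := eqVneq u 0; first by rewrite add0r.
  have [/vlineP[k ->]|vu] := boolP (v \in <[u]>%VS).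
    by rewrite -[X in inA (X + _)]scale1r -scalerDl; apply: inAZ.
  have i : indep u v by rewrite /indep u0.
  have [v0 _] := andP (indep_sym i).
  have [l lE] := line_through i.
  have [P Pu] := point_of u0; have [R Rv] := point_of v0.
  have Pl : P \in pts l by rewrite (in_pts_vline _ Pu) lE mem_joinl.
  have Rl : R \in pts l by rewrite (in_pts_vline _ Rv) lE mem_joinr.
  have PR : P != R.
    by apply: contraNneq vu => PR; rewrite -Pu PR Rv memv_line.
  have lA : (f l <= A)%VS.
    apply: (@line_sub_plane _ _ (phi P) (phi R)); rewrite ?fE ?imset_f //.
    - by rewrite (inj_eq perm_inj).
    - exact: inAP uA Pu.
    - exact: inAP vA Rv.
  apply/forallP => S; apply/implyP => /eqP Suv.
  have : phi S \in pts (f l).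
    rewrite fE imset_f // (in_pts_vline _ Suv) lE; apply/mem_joinP.
    by exists 1, 1; rewrite !scale1r.
  by rewrite inE => /subv_trans; apply.
pose W := <<[seq v <- enum 'rV[F]_4 | inA v]>>%VS.
have memW v : (v \in W) = inA v.
  apply/idP/idP => [vW|vA]; last first.
    by apply: memv_span; rewrite mem_filter vA mem_enum.
  rewrite (coord_span (X := in_tuple _) vW).
  elim/big_ind: _ => // i _; apply: inAZ; rewrite /=.
  have : [seq v <- enum 'rV[F]_4 | inA v]`_i \in
    [seq v <- enum 'rV[F]_4 | inA v] by rewrite mem_nth.
  by rewrite mem_filter => /andP[].
have fW l : (l <= W)%VS -> l \in L.
  move=> lW; rewrite -(mem_imset _ _ f_inj) -(line_image_imset _ fE).
  apply: (subsetP sub); rewrite inE; apply/subvP => x xl.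
  have [->|x0] := eqVneq x 0; first by rewrite mem0v.
  have [R Rx] := point_of x0.
  have : R \in pts (f l) by rewrite (in_pts_vline _ Rx).
  rewrite fE => /imsetP[P Pl RP]; have [y y0 Py] := pointP P.
  rewrite memvE -Rx RP; apply: (inAP _ _ _ Py); rewrite -memW (subvP lW) //.
  by rewrite -(in_pts_vline _ Py).
(* If [dim W <= 2], a complement of [W] contains a line. Its image meets [A], and the preimage of a
   common point lies both in [W] and in the complement. *)
exists W => //; rewrite leqNgt; apply/negP => dW.
have dC : (2 <= \dim W^C)%N.
  by rewrite dimv_compl dimvf dim_matrix; case: (\dim W) dW => [|[|[|]]].
have u0 : vpick W^C != 0 by rewrite vpick0 -dimv_eq0; move: dC; case: (\dim _).
have /subvPn[v vC vu] : ~~ (W^C <= <[vpick W^C]>)%VS.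
  by apply/negP => /dimvS; rewrite dim_vline u0 => /(leq_trans dC).
have i : indep (vpick W^C) v by rewrite /indep u0.
have [l lE] := line_through i.
have lC : (l <= W^C)%VS by rewrite lE subv_add -!memvE memv_pick.
have d0 : (f l :&: A)%VS != 0%VS.
  rewrite -dimv_eq0 -lt0n; have := dimv_sum_cap (f l) A.
  rewrite (eqP (subsp_dim (f l))) (eqP (subsp_dim A)).
  have := dimvS (subvf (f l + A)%VS); rewrite dimvf dim_matrix; lia.
have r0 : vpick (f l :&: A)%VS != 0 by rewrite vpick0.
have [R Rr] := point_of r0.
have : vpick (f l :&: A)%VS \in (f l :&: A)%VS := memv_pick _.
rewrite memv_cap -(in_pts_vline _ Rr) fE => /andP[/imsetP[P Pl RP] rA].
have [y y0 Py] := pointP P.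
have yW : y \in W.
  rewrite memW; apply/forallP => S; apply/implyP => /eqP Sy.
  have -> : S = P by apply: val_inj; rewrite [LHS]Sy [RHS]Py.
  by rewrite -RP Rr -memvE.
have yC : y \in (W^C)%VS.
  by apply: (subvP lC); rewrite -(in_pts_vline _ Py).
have : y \in (W :&: W^C)%VS by rewrite memv_cap yW yC.
by rewrite capv_compl memv0 (negbTE y0).
Qed.

End Collineations.

(* Inequivalence with the known classes *)
Local Close Scope ring_scope.

Theorem theorem3p13 (F : finFieldType) (w l1 l2 : F)
    (q_odd : odd #|F|) (q_ge7 : 7 <= #|F|)
    (w_nonsquare : nonsquare w)
    (l1_square : nonzero_square l1) (l2_nonsquare : nonsquare l2) :
  [/\ ~ equivalent (Lthird w l1 l2) (Lprime w),
      ~ equivalent (Lthird w l1 l2) (Lsecond w),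
      forall (X : {set line F}) (A : plane F),
        cameron_liebler ((#|F| ^ 2 - 1) %/ 2) X ->
        [disjoint X & lines_of_plane A] ->
        cameron_liebler ((#|F| ^ 2 + 1) %/ 2) (X :|: lines_of_plane A) ->
        ~ equivalent (Lthird w l1 l2) (X :|: lines_of_plane A)
    & forall (X : {set line F}) (P : point F),
        cameron_liebler ((#|F| ^ 2 - 1) %/ 2) X ->
        [disjoint X & lines_through P] ->
        cameron_liebler ((#|F| ^ 2 + 1) %/ 2) (X :|: lines_through P) ->
        ~ equivalent (Lthird w l1 l2) (X :|: lines_through P)].
Proof.
(* The degree of this point in [L'''] is the degree of no point in [L'] or in [L'']. *)
have [P0 /negP ngap] := Lthird_gap q_odd q_ge7 w_nonsquare l1_square l2_nonsquare.
split.
- move=> /(deg_equivalent P0)[R eR]; apply: ngap; rewrite -eR.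
  exact: gap_Lprime.
- move=> /(deg_equivalent P0)[R eR]; apply: ngap; rewrite -eR.
  exact: gap_Lsecond.
- move=> X A _ _ _ eqv.
  have [W dW allL] := equivalent_plane eqv (subsetUr _ _).
  have [l lW /negP] :=
    plane_missing q_odd q_ge7 w_nonsquare l1_square l2_nonsquare dW.
  by apply; apply: allL.
- move=> X P _ _ _ eqv.
  have [R allL] := equivalent_star eqv (subsetUr _ _).
  have [l Rl /negP] := star_missing l1 q_odd w_nonsquare l2_nonsquare R.
  by apply; apply: allL.
Qed.
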